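(* Let $K$ be a field, $S=K[x_1,\dots,x_n]$ a polynomial ring, $j\ge 2$ an integer, and let $I\subsetneq S$ be a (proper) squarefree monomial ideal with $\mathrm{grade}\, I\geq j$. The following conditions are equivalent: (i) $\mathrm{Fitt}_{j-1}(I)=I$. (ii) $\mathrm{Fitt}_{j-1}(I)$ is a squarefree monomial ideal. (iii) If $j=2$, then $I$ is a perfect ideal with $\mathrm{grade}\, I=2$, and if $j>2$, then $I$ is generated by a regular sequence of length $j$.
   Context: For a finitely generated module $M$ over a Noetherian ring $R$, choose a finite free presentation $G\to F\to M\to 0$ with $\mathrm{rank}\,F=r$, and let $A$ be a matrix representing $G\to F$. The $j$th Fitting ideal of $M$ is $\mathrm{Fitt}_j(M)=I_{r-j}(A)$, where $I_t(A)$ is the ideal generated by the $t$-minors of $A$, with $I_t(A)=R$ for $t\le 0$. This is independent of the choices. An ideal $I$ is regarded as a module over the ring. A squarefree monomial ideal is an ideal generated by squarefree monomials. $\mathrm{grade}\,I$ is the length of a maximal regular sequence contained in $I$. An ideal $I$ of $S$ is perfect if the projective dimension of $S/I$ equals $\mathrm{grade}\,I$. *)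

(* Defs.v *)
From HB Require Import structures.
From mathcomp Require Import all_boot all_order all_algebra.
From mathcomp Require Import generic_quotient ring_quotient.
From mathcomp Require Import boolp classical_sets.
From mathcomp Require Import mpoly.

Set Implicit Arguments.
Unset Strict Implicit.
Unset Printing Implicit Defensive.

Import GRing.Theory.
Local Open Scope ring_scope.
Local Open Scope quotient_scope.

(* Submodules are the [submodClosed] predicates of MathComp (boolean, hence
   decided classically when they are defined by a proposition).  An ideal of R
   is a submodule of the regular module R^o. *)
Notation idealOf R := (submodClosed (R^o)%type).

Section SubmoduleAndQuotient.
Variables (R : nzRingType) (V : lmodType R) (N : submodClosed V).

Definition submod : Type := {x : V | x \in N}.

HB.instance Definition _ := SubChoice.on submod.
HB.instance Definition _ :=
  GRing.SubChoice_isSubLmodule.Build R V _ submod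
    (GRing.subsemimodClosedP N).

(* [submodClosed] does not record closure under opposite, which
   [Quotient.quot] asks for. *)
Definition submod_pred : {pred V} := fun x => x \in N.

Lemma submod_pred_zmod : zmod_closed submod_pred.
Proof.
split=> [|x y xN yN]; first exact: (rpred0 N).
rewrite unfold_in /submod_pred -scaleN1r.
by apply: rpredD => //; apply: rpredZ.
Qed.

HB.instance Definition _ := GRing.isZmodClosed.Build V submod_pred
  submod_pred_zmod.

Definition quotmod : Type := Quotient.quot submod_pred.

HB.instance Definition _ := GRing.Zmodule.on quotmod.

Definition quotmod_pi (x : V) : quotmod := \pi_(Quotient.quot submod_pred) x.

Definition quotmod_scale (a : R) (x : quotmod) : quotmod :=
  quotmod_pi (a *: repr (x : Quotient.quot submod_pred)).

Lemma quotmod_pi_eq (x y : V) :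
  (quotmod_pi x == quotmod_pi y) = (x - y \in N).
Proof. by rewrite -(Quotient.idealrBE submod_pred). Qed.

Lemma quotmod_piD : {morph quotmod_pi : x y / x + y}.
Proof. by move=> x y; rewrite /quotmod_pi raddfD. Qed.

Lemma quotmod_piZ a x : quotmod_scale a (quotmod_pi x) = quotmod_pi (a *: x).
Proof.
apply/eqP; rewrite quotmod_pi_eq -scalerBr; apply: rpredZ.
by rewrite -quotmod_pi_eq /quotmod_pi reprK.
Qed.

Lemma quotmod_surj (x : quotmod) : exists y, x = quotmod_pi y.
Proof. by exists (repr (x : Quotient.quot submod_pred)); rewrite /quotmod_pi reprK. Qed.

Lemma quotmod_scaleA a b v :
  quotmod_scale a (quotmod_scale b v) = quotmod_scale (a * b) v.
Proof. by have [y ->] := quotmod_surj v; rewrite !quotmod_piZ scalerA. Qed.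

Lemma quotmod_scale1 : left_id 1 quotmod_scale.
Proof. by move=> v; have [y ->] := quotmod_surj v; rewrite quotmod_piZ scale1r. Qed.

Lemma quotmod_scaleDr : right_distributive quotmod_scale +%R.
Proof.
move=> a u v; have [x ->] := quotmod_surj u; have [y ->] := quotmod_surj v.
by rewrite -quotmod_piD !quotmod_piZ scalerDr quotmod_piD.
Qed.

Lemma quotmod_scaleDl v : {morph quotmod_scale^~ v : a b / a + b}.
Proof.
move=> a b; have [y ->] := quotmod_surj v.
by rewrite !quotmod_piZ scalerDl quotmod_piD.
Qed.

HB.instance Definition _ := GRing.Zmodule_isLmodule.Build R quotmod
  quotmod_scaleA quotmod_scale1 quotmod_scaleDr quotmod_scaleDl.

End SubmoduleAndQuotient.

Section GeneratedIdeal.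
Variables (R : comNzRingType) (G : R -> Prop).

Definition ideal_gen : {pred R^o} := fun x =>
  `[< exists (k : nat) (a g : 'I_k -> R),
        (forall i, G (g i)) /\ x = \sum_(i < k) a i * g i >].

Lemma ideal_gen_submod : subsemimod_closed ideal_gen.
Proof.
split=> [|a x /asboolP[k [b [g [Gg ->]]]]]; last first.
  apply/asboolP; exists k, (fun i => a * b i), g; split=> //.
  by rewrite /GRing.scale /= mulr_sumr; apply: eq_bigr => i _; rewrite mulrA.
split=> [|x y /asboolP[k [b [g [Gg ->]]]] /asboolP[l [c [h [Hh ->]]]]].
  by apply/asboolP; exists 0%N, (fun _ => 0), (fun _ => 0);
    split=> [[]|]; rewrite ?big_ord0.
apply/asboolP; exists (k + l)%N.
exists (fun i => match split i with inl j => b j | inr j => c j end).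
exists (fun i => match split i with inl j => g j | inr j => h j end).
split=> [i|]; first by case: (split i).
rewrite big_split_ord /=; congr (_ + _); apply: eq_bigr => i _.
  by rewrite (unsplitK (inl i)).
by rewrite (unsplitK (inr i)).
Qed.

HB.instance Definition _ := GRing.isSubmodClosed.Build R R^o ideal_gen
  ideal_gen_submod.

End GeneratedIdeal.

Definition ideal_seq (R : comNzRingType) (s : seq R) : idealOf R :=
  ideal_gen (fun x => x \in s).

Section Fitting.
Variable R : comNzRingType.

Definition minors_ideal (m r t : nat) (A : 'M[R]_(m, r)) : idealOf R :=
  ideal_gen (fun d => exists (f : 'I_t -> 'I_m) (g : 'I_t -> 'I_r),
    [/\ {homo f : i j / (i < j)%N}, {homo g : i j / (i < j)%N}
      & d = \det (mxsub f g A)]).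

(* Exactness of R^m -> R^r -> M -> 0, where the first map is v |-> v *m A on
   row vectors. *)
Definition presents (M : lmodType R) (m r : nat) (A : 'M[R]_(m, r)) : Prop :=
  exists phi : {linear 'rV[R]_r -> M},
    (forall x, exists u, phi u = x) /\
    (forall u, phi u = 0 <-> exists v : 'rV[R]_m, u = v *m A).

Definition matrix_of_dims (mr : nat * nat) : Type := 'M[R]_(mr.1, mr.2).

(* The zero default is only used when M has no finite presentation, which does
   not happen for a finitely generated module over a Noetherian ring. *)
Definition choose_presentation (M : lmodType R) : {mr & matrix_of_dims mr} :=
  xget (Tagged matrix_of_dims (0 : 'M[R]_((0, 0)%N.1, (0, 0)%N.2)))
       (fun A => presents M (tagged A)).

(* r = (tag A).2.  For j >= r the truncated difference is 0, and the only
   0-minor is 1, in accordance with I_t(A) = R for t <= 0. *)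
Definition Fitt (j : nat) (M : lmodType R) : idealOf R :=
  let A := choose_presentation M in
  minors_ideal ((tag A).2 - j) (tagged A).

End Fitting.

Section GradeAndPerfection.
Variable R : comNzRingType.

(* The entry s`_i acts injectively on R / (s_0, ..., s_(i-1)), and
   R / (s) is nonzero. *)
Definition regular_seq (s : seq R) : Prop :=
  (forall i, (i < size s)%N -> forall x : quotmod (ideal_seq (take i s)),
     s`_i *: x = 0 -> x = 0) /\
  1 \notin ideal_seq s.

Definition maximal_regular_seq_in (I : idealOf R) (s : seq R) : Prop :=
  [/\ regular_seq s, {subset s <= I}
    & forall y, y \in I -> ~ regular_seq (rcons s y)].

Definition has_grade (I : idealOf R) (g : nat) : Prop :=
  exists2 s, maximal_regular_seq_in I s & size s = g.

Definition projective (P : lmodType R) : Prop :=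
  forall (M N : lmodType R) (f : {linear M -> N}) (g : {linear P -> N}),
    (forall y, exists x, f x = y) ->
    exists h : {linear P -> M}, forall x, f (h x) = g x.

Definition projective_resolution (M : lmodType R) (P : nat -> lmodType R)
    (d : forall i, {linear P i.+1 -> P i}) (eps : {linear P 0%N -> M}) : Prop :=
  [/\ forall i, projective (P i),
      forall y, exists x, eps x = y,
      forall x, eps x = 0 <-> exists y, d 0%N y = x
    & forall i x, d i x = 0 <-> exists y, d i.+1 y = x].

(* M has a projective resolution of length at most k. *)
Definition pdim_le (M : lmodType R) (k : nat) : Prop :=
  exists (P : nat -> lmodType R) (d : forall i, {linear P i.+1 -> P i})
    (eps : {linear P 0%N -> M}),
    projective_resolution d eps /\
    forall i, (k < i)%N -> forall x : P i, x = 0.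

Definition has_pdim (M : lmodType R) (k : nat) : Prop :=
  pdim_le M k /\ forall l, pdim_le M l -> (k <= l)%N.

Definition perfect (I : idealOf R) : Prop :=
  exists2 g, has_grade I g & has_pdim (quotmod I) g.

End GradeAndPerfection.

Definition squarefree_monomial_ideal (n : nat) (K : fieldType)
    (I : idealOf {mpoly K[n]}) : Prop :=
  exists2 G : 'X_{1..n} -> Prop,
    forall m, G m -> forall i, (m i <= 1)%N
    & I =i ideal_gen (fun p => exists2 m, G m & p = 'X_[K, m]).

(* Main.v *)
Require Import Defs.
From HB Require Import structures.
From mathcomp Require Import all_boot all_order perm all_algebra.
From mathcomp Require Import boolp.
From mathcomp Require Import mpoly zify ring.

Set Implicit Arguments.
Unset Strict Implicit.
Unset Printing Implicit Defensive.

Import GRing.Theory.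
Local Open Scope ring_scope.

(** Let [u a], for [a] in ['I_r], be the supports of the minimal monomial generators
    of [I]. The relations between the generators are spanned by the Taylor relations,
    one for each pair, and presentations may be exchanged for one another in the
    definition of Fitting ideals ([Fitt_presents]). A nonzero minor of size
    [r - (j - 1)] of the Taylor relations belongs to a spanning forest on the set of
    generators with [j - 1] roots, and up to sign it is the product, over the edges
    from a parent [p] to a child [v], of the variables in [u p :\: u v]
    ([edge_minor_forest], [forest_minor]). Thus [Fitt (j - 1) I] is a monomial ideal
    described by forests, and everything becomes a question about how variables are
    lost along edges.

    The grade enters through covers, sets of variables that meet every [u a]: a
    regular sequence in an ideal with [c] generators has length at most [c]
    ([regular_seq_size_le]), so every cover has at least [j] elements. This
    makes each forest monomial divisible by a generator ([forest_support_gen]), hence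
    the Fitting ideal is contained in [I]. Star-shaped forests put powers of the
    generators in the Fitting ideal. So the two ideals have the same radical, and they
    agree if and only if the Fitting ideal is squarefree.

    If they agree, each generator [u i] has a forest whose monomial divides it. In
    such a forest variables outside [u i] are never lost, and those of [u i] at most
    once. For [j = 2] the forest is a tree, its edges are a basis of all relations
    ([tree_resolution]), and it yields a cover with two elements; hence [I] has
    grade and projective dimension two. For [j > 2] there is a second root, and
    since covers have at least [j] elements, its support is disjoint from all the
    others ([root_disjoint_all]); its own forest then has only one edge, so [r = j],
    the supports are pairwise disjoint and the generators form a regular sequence
    ([efficient_forests_few], [disjoint_of_few]).

    Conversely, for [j > 2], an ideal generated by [j] elements has at most [j] minimal
    monomial generators ([gens_le_generators]); then again the supports are pairwise
    disjoint, and forests with one edge give all of [I]. For [j = 2] and [I]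
    perfect, a comparison of resolutions shows that some of the Taylor relations are
    free and generate all relations up to a factor with nonzero constant term
    ([free_relations]), and the maximal minors of these are the generators up to sign
    ([grade_two_forests]). The grade in the definition of perfection is the
    length of some maximal regular sequence; that it is at most two follows from the
    exchange argument [grade2_max], which rests on prime avoidance and therefore on
    the Noetherian property of polynomial rings. *)

(** * Ideals, generators and regular sequences *)

Section Ideals.
Variable R : comNzRingType.
Implicit Types (J : idealOf R) (G H : R -> Prop) (s : seq R) (a b x y : R).

Lemma idealMl J a x : x \in J -> a * x \in J.
Proof. exact: (@rpredZ R (R^o)%type J a x). Qed.

Lemma idealMr J a x : x \in J -> x * a \in J.
Proof. by rewrite mulrC; apply: idealMl. Qed.

Lemma idealD J x y : x \in J -> y \in J -> x + y \in J.
Proof. exact: (@rpredD (R^o)%type J x y). Qed.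

Lemma idealN J x : x \in J -> - x \in J.
Proof. by move=> xJ; rewrite -mulN1r; apply: idealMl. Qed.

Lemma idealB J x y : x \in J -> y \in J -> x - y \in J.
Proof. by move=> xJ yJ; apply: idealD => //; apply: idealN. Qed.

Lemma ideal0 J : 0 \in J.
Proof. exact: (@rpred0 (R^o)%type J). Qed.

Lemma ideal_sum J (I : Type) (r : seq I) (P : pred I) (F : I -> R) :
  (forall i, P i -> F i \in J) -> \sum_(i <- r | P i) F i \in J.
Proof.
by move=> FJ; elim/big_rec: _ => [|i x Pi xJ];
  [apply: ideal0|apply: idealD => //; apply: FJ].
Qed.

Lemma mem_ideal_gen G x : G x -> x \in ideal_gen G.
Proof.
move=> Gx; apply/asboolP; exists 1%N, (fun=> 1), (fun=> x); split=> //.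
by rewrite big_ord1 mul1r.
Qed.

Lemma ideal_genP G J :
  (forall x, G x -> x \in J) <-> {subset ideal_gen G <= J}.
Proof.
split=> [GJ x /asboolP[k [a [g [Gg ->]]]]|GJ x Gx]; last exact/GJ/mem_ideal_gen.
by apply: ideal_sum => i _; apply: idealMl; apply: GJ.
Qed.

Lemma ideal_genS G H :
  (forall x, G x -> x \in ideal_gen H) -> {subset ideal_gen G <= ideal_gen H}.
Proof. by move/ideal_genP. Qed.

Lemma mem_ideal_seq s x : x \in s -> x \in ideal_seq s.
Proof. exact: mem_ideal_gen. Qed.

Lemma ideal_seq_sub s J : {subset s <= J} -> {subset ideal_seq s <= J}.
Proof. exact: (ideal_genP (fun x => x \in s) J).1. Qed.

Lemma ideal_seqP s x :
  reflect (exists a : 'I_(size s) -> R, x = \sum_i a i * s`_i)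
    (x \in ideal_seq s).
Proof.
apply: (iffP idP) => [/asboolP[k [b [g [gs ->]]]]|[a ->]]; last first.
  by apply: ideal_sum => i _; apply: idealMl; apply/mem_ideal_seq/mem_nth.
have idx i : (index (g i) s < size s)%N by rewrite index_mem.
exists (fun l => \sum_(i < k | Ordinal (idx i) == l) b i).
under [RHS]eq_bigr do rewrite mulr_suml.
rewrite (exchange_big_dep predT) //=; apply: eq_bigr => i _.
by rewrite (big_pred1 (Ordinal (idx i))) ?nth_index.
Qed.

Lemma ideal_seq_cat s1 s2 x : x \in ideal_seq (s1 ++ s2) ->
  exists y z, [/\ y \in ideal_seq s1, z \in ideal_seq s2 & x = y + z].
Proof.
case/asboolP=> k [b [g [gs ->]]].
exists (\sum_(i < k | g i \in s1) b i * g i).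
exists (\sum_(i < k | g i \notin s1) b i * g i); split.
- by apply: ideal_sum => i gi; apply/idealMl/mem_ideal_seq.
- apply: ideal_sum => i gi; apply/idealMl/mem_ideal_seq.
  by have := gs i; rewrite mem_cat (negPf gi).
- exact: bigID.
Qed.

Lemma ideal_seq1P a x :
  x \in ideal_seq [:: a] -> exists b, x = b * a.
Proof. by case/ideal_seqP=> b ->; rewrite big_ord1; exists (b ord0). Qed.

Lemma ideal_seq_nil x : x \in ideal_seq ([::] : seq R) -> x = 0.
Proof. by case/ideal_seqP=> a ->; rewrite big_ord0. Qed.

Lemma ideal_seq_rcons s a x : x \in ideal_seq (rcons s a) ->
  exists y b, y \in ideal_seq s /\ x = y + b * a.
Proof.
rewrite -cats1 => /ideal_seq_cat[y [z [ys /ideal_seq1P[b ->] ->]]].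
by exists y, b.
Qed.

Lemma ideal_seq2P a b x :
  x \in ideal_seq [:: a; b] -> exists p q, x = p * a + q * b.
Proof.
case/(@ideal_seq_rcons [:: a])=> y [q [/ideal_seq1P[p ->] ->]].
by exists p, q.
Qed.

Lemma pi_eq0 J x : (quotmod_pi J x == 0) = (x \in J).
Proof.
have -> : 0 = quotmod_pi J 0 by apply/esym; rewrite /quotmod_pi raddf0.
by rewrite quotmod_pi_eq subr0.
Qed.

Lemma scale_pi J a x : a *: quotmod_pi J x = quotmod_pi J (a * x).
Proof. exact: quotmod_piZ. Qed.

Lemma regular_seqP s : regular_seq s <->
  (forall i, (i < size s)%N -> forall x,
    s`_i * x \in ideal_seq (take i s) -> x \in ideal_seq (take i s)) /\
  1 \notin ideal_seq s.
Proof.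
split=> -[reg s1]; split=> // i lt_i x.
  rewrite -!pi_eq0 -scale_pi => /eqP sx0.
  by apply/eqP; apply: reg lt_i _ sx0.
have [y ->] := quotmod_surj x; rewrite scale_pi => /eqP.
by rewrite pi_eq0 => /(reg i lt_i); rewrite -pi_eq0 => /eqP.
Qed.

Lemma regular_seq_rcons s y : regular_seq s ->
  (forall x, y * x \in ideal_seq s -> x \in ideal_seq s) ->
  1 \notin ideal_seq (rcons s y) -> regular_seq (rcons s y).
Proof.
move=> /regular_seqP[reg _] y_reg sy1; apply/regular_seqP; split=> // i.
rewrite size_rcons ltnS leq_eqVlt => /predU1P[->|lt_i] x.
  by rewrite nth_rcons ltnn eqxx -cats1 take_size_cat //; apply: y_reg.
by rewrite nth_rcons lt_i -cats1 takel_cat ?(ltnW lt_i) //; apply: reg.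
Qed.

End Ideals.

(** * Regular sequences in an ideal with few generators *)

(** The Koszul complex of [x 0, ..., x c.-1], as one ungraded free module of
    rank [2 ^ c] with its differential: the recursion on [c] is the mapping cone
    of the multiplication by [x c], and makes all its identities inductions over
    two components. *)
Section Koszul.
Variable R : comNzRingType.

Fixpoint kos (c : nat) : lmodType R :=
  if c is c'.+1 then (kos c' * kos c')%type : lmodType R else R^o.

Fixpoint kos_diff (x : nat -> R) (c : nat) : kos c -> kos c :=
  match c return kos c -> kos c with
  | 0 => fun _ => 0
  | c'.+1 => fun w => (kos_diff x w.1 + x c' *: w.2, - kos_diff x w.2)
  end.

(** Left multiplication by the linear form with coefficients [a 0, a 1, ...] in
    the exterior algebra; by [kos_homotopy] it is a homotopy from [0] to the
    multiplication by the value of this form at [x]. *)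
Fixpoint kos_mul (a : nat -> R) (c : nat) : kos c -> kos c :=
  match c return kos c -> kos c with
  | 0 => fun _ => 0
  | c'.+1 => fun w => (kos_mul a w.1, a c' *: w.1 - kos_mul a w.2)
  end.

(** The part of exterior degree at least [k], which replaces a grading. *)
Fixpoint kos_deg_ge (k c : nat) : kos c -> Prop :=
  match c return kos c -> Prop with
  | 0 => fun w => k = 0%N \/ w = 0
  | c'.+1 => fun w => kos_deg_ge k w.1 /\ kos_deg_ge k.-1 w.2
  end.

(** The submodule of the multiples of [J]. *)
Fixpoint kos_in (J : idealOf R) (c : nat) : kos c -> Prop :=
  match c return kos c -> Prop with
  | 0 => fun w => (w : R^o) \in J
  | c'.+1 => fun w => kos_in J w.1 /\ kos_in J w.2
  end.

Fixpoint kos_cst (b : R) (c : nat) : kos c :=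
  match c return kos c with
  | 0 => b
  | c'.+1 => (kos_cst b c', 0)
  end.

(** The component of exterior degree [0]. *)
Fixpoint kos_aug (c : nat) : kos c -> R :=
  match c return kos c -> R with
  | 0 => id
  | c'.+1 => fun w => kos_aug w.1
  end.

Implicit Types (x a : nat -> R) (J : idealOf R).

Lemma kos_diffZD x c b (v w : kos c) :
  kos_diff x (b *: v + w) = b *: kos_diff x v + kos_diff x w.
Proof.
elim: c v w => [|c IH] v w /=; first by rewrite scaler0 addr0.
rewrite !IH; congr (_, _) => /=.
  by rewrite !scalerDr !scalerA (mulrC b) !addrA; congr (_ + _); rewrite addrAC.
by rewrite opprD scalerN.
Qed.

Lemma kos_mulZD a c b (v w : kos c) :
  kos_mul a (b *: v + w) = b *: kos_mul a v + kos_mul a w.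
Proof.
elim: c v w => [|c IH] v w /=; first by rewrite scaler0 addr0.
rewrite !IH; congr (_, _) => /=.
rewrite !scalerDr !scalerA (mulrC b) opprD scalerN !addrA; congr (_ + _).
by rewrite addrAC.
Qed.

Lemma kos_diff0 x c : kos_diff x (0 : kos c) = 0.
Proof. by have := kos_diffZD x (-1) (0 : kos c) 0;
  rewrite !scaleN1r oppr0 addr0 addNr. Qed.

Lemma kos_diffD x c (v w : kos c) : kos_diff x (v + w) = kos_diff x v +
  kos_diff x w.
Proof. by have := kos_diffZD x 1 v w; rewrite !scale1r. Qed.

Lemma kos_diffZ x c b (v : kos c) : kos_diff x (b *: v) = b *: kos_diff x v.
Proof. by have := kos_diffZD x b v 0; rewrite kos_diff0 !addr0. Qed.

Lemma kos_diffN x c (v : kos c) : kos_diff x (- v) = - kos_diff x v.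
Proof. by rewrite -!scaleN1r kos_diffZ. Qed.

Lemma kos_mul0 a c : kos_mul a (0 : kos c) = 0.
Proof. by have := kos_mulZD a (-1) (0 : kos c) 0;
  rewrite !scaleN1r oppr0 addr0 addNr. Qed.

Lemma kos_mulD a c (v w : kos c) : kos_mul a (v + w) = kos_mul a v + kos_mul a
  w.
Proof. by have := kos_mulZD a 1 v w; rewrite !scale1r. Qed.

Lemma kos_mulZ a c b (v : kos c) : kos_mul a (b *: v) = b *: kos_mul a v.
Proof. by have := kos_mulZD a b v 0; rewrite kos_mul0 !addr0. Qed.

Lemma kos_mulN a c (v : kos c) : kos_mul a (- v) = - kos_mul a v.
Proof. by rewrite -!scaleN1r kos_mulZ. Qed.

Lemma kos_diff_diff x c (w : kos c) : kos_diff x (kos_diff x w) = 0.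
Proof.
elim: c w => [|c IH] w //=.
by rewrite kos_diffD kos_diffZ kos_diffN !IH add0r scalerN subrr !oppr0.
Qed.

Lemma kos_homotopy x a c (w : kos c) :
  kos_diff x (kos_mul a w) + kos_mul a (kos_diff x w) =
  (\sum_(i < c) a i * x i) *: w.
Proof.
elim: c w => [|c IH] w /=; first by rewrite big_ord0 scale0r addr0.
case: w => w1 w2 /=; rewrite big_ord_recr /=.
have lin (V : lmodType R) (p q : V) (e f : V) (b d t : R) :
    e + f = t *: p -> (e + b *: (d *: p - q)) + (f + b *: q) = (t + d * b) *: p.
  by move=> ef; rewrite scalerDl -ef scalerBr scalerA (mulrC b) addrACA subrK.
have lin' (V : lmodType R) (p d e f : V) (b t : R) :
    e + f = t *: p -> (e - d) + (d + b *: p + f) = (t + b) *: p.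
  by move=> ef; rewrite scalerDl -ef -(addrA d) [LHS]addrA subrK addrCA addrC.
congr (_, _) => /=.
  by rewrite kos_mulD kos_mulZ; apply: lin; apply: IH.
rewrite kos_diffD kos_diffN kos_diffZ kos_mulN opprB scalerDr scalerA opprK.
by apply: lin'; apply: IH.
Qed.

Lemma kos_aug_diff x c (w : kos c) (J : idealOf R) :
  (forall i, (i < c)%N -> x i \in J) -> kos_aug (kos_diff x w) \in J.
Proof.
elim: c w => [|c IH] w xJ /=; first exact: ideal0.
have aug_lin d (b : R) (v v' : kos d) :
    kos_aug (v + b *: v') = kos_aug v + b * kos_aug v'.
  by elim: d v v' => [//|d IHd] v v' /=; rewrite IHd.
rewrite aug_lin; apply: idealD; last by apply: idealMr; apply: xJ.
by apply: IH => i lt_i; apply: xJ; apply: ltnW.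
Qed.

Lemma kos_aug_cst b c : kos_aug (kos_cst b c) = b.
Proof. by elim: c. Qed.

Lemma kos_deg_ge0 c (w : kos c) : kos_deg_ge 0 w.
Proof. by elim: c w => [|c IH] w /=; [left|split; apply: IH]. Qed.

Lemma kos_deg_ge_zero k c : kos_deg_ge k (0 : kos c).
Proof. by elim: c k => [|c IH] k /=; [right|split; apply: IH]. Qed.

Lemma kos_deg_ge_lin c k (b : R) (v w : kos c) :
  kos_deg_ge k v -> kos_deg_ge k w -> kos_deg_ge k (b *: v + w).
Proof.
elim: c k v w => [|c IH] k v w /=.
  by case=> [->|->]; [left|case=> [->|->]; [left|right; rewrite scaler0 addr0]].
by move=> [v1 v2] [w1 w2]; split; apply: IH.
Qed.

Lemma kos_deg_geW c k (w : kos c) : kos_deg_ge k.+1 w -> kos_deg_ge k w.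
Proof.
elim: c k w => [|c IH] k w /=; first by case=> // ->; right.
by case=> w1 w2; split; [apply: IH|case: k w1 w2 => [|k] w1 w2 //; apply: IH].
Qed.

Lemma kos_deg_ge_mul a c k (w : kos c) :
  kos_deg_ge k w -> kos_deg_ge k.+1 (kos_mul a w).
Proof.
elim: c k w => [|c IH] k w /=; first by right.
case=> w1 w2; split; first exact: IH.
rewrite -scaleN1r; apply: kos_deg_ge_lin => //.
case: k w1 w2 => [|k] w1 w2 /=; first by rewrite scaleN1r; apply: kos_deg_ge0.
rewrite -[X in kos_deg_ge _ X]addr0; apply: kos_deg_ge_lin; first exact: IH.
exact: kos_deg_ge_zero.
Qed.

Lemma kos_deg_gt c (w : kos c) : kos_deg_ge c.+1 w -> w = 0.
Proof.
elim: c w => [|c IH] w /=; first by case.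
by case: w => w1 w2 /= [/kos_deg_geW/IH-> /IH->].
Qed.

Lemma kos_in_lin J c (b : R) (v w : kos c) :
  kos_in J v -> kos_in J w -> kos_in J (b *: v + w).
Proof.
elim: c v w => [|c IH] v w /=; last by move=> [v1 v2] [w1 w2]; split; apply: IH.
by move=> vJ wJ; apply: idealD => //; apply: idealMl.
Qed.

Lemma kos_in0 J c : kos_in J (0 : kos c).
Proof. by elim: c => [|c IH] /=; [apply: ideal0|split]. Qed.

Lemma kos_inZ J c (b : R) (v : kos c) : kos_in J v -> kos_in J (b *: v).
Proof. by move=> vJ; rewrite -[_ *: _]addr0; apply/kos_in_lin/kos_in0. Qed.

Lemma kos_inD J c (v w : kos c) : kos_in J v -> kos_in J w -> kos_in J (v + w).
Proof. by move=> vJ wJ; rewrite -[v]scale1r; apply: kos_in_lin. Qed.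

Lemma kos_inB J c (v w : kos c) : kos_in J v -> kos_in J w -> kos_in J (v - w).
Proof. by move=> vJ wJ; apply: kos_inD => //; rewrite -scaleN1r;
  apply: kos_inZ. Qed.

Lemma kos_in_diff x J c (w : kos c) : kos_in J w -> kos_in J (kos_diff x w).
Proof.
elim: c w => [|c IH] w /=; first by move=> _; apply: ideal0.
case=> w1 w2; split; first by apply: kos_inD; [apply: IH|apply: kos_inZ].
by rewrite -scaleN1r; apply: kos_inZ; apply: IH.
Qed.

Lemma kos_in_mul a J c (w : kos c) : kos_in J w -> kos_in J (kos_mul a w).
Proof.
elim: c w => [|c IH] w /=; first by move=> _; apply: ideal0.
case=> w1 w2; split; first exact: IH.
by apply: kos_inB; [apply: kos_inZ|apply: IH].
Qed.

Lemma kos_inS J J' c (w : kos c) :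
  {subset J <= J'} -> kos_in J w -> kos_in J' w.
Proof.
by move=> JJ'; elim: c w => [|c IH] w /=; [apply: JJ'|case=> *; split;
  apply: IH].
Qed.

Lemma kos_in_reg J b c (w : kos c) :
  (forall y, b * y \in J -> y \in J) -> kos_in J (b *: w) -> kos_in J w.
Proof.
move=> reg; elim: c w => [|c IH] w /=; first exact: reg.
by case=> *; split; apply: IH.
Qed.

Lemma kos_in_rcons (s : seq R) b c (w : kos c) : kos_in (ideal_seq (rcons s b))
  w ->
  exists v y : kos c, kos_in (ideal_seq s) v /\ w = v + b *: y.
Proof.
elim: c w => [|c IH] w /=.
  by move/ideal_seq_rcons=> [v [y [vs ->]]]; exists v, y; rewrite mulrC.
case: w => w1 w2 /= [/IH[v1 [y1 [? ->]]] /IH[v2 [y2 [? ->]]]].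
by exists (v1, v2), (y1, y2).
Qed.

(** The number of generators bounds the length of regular sequences. Exterior
    multiplication by linear forms representing [s`_0, s`_1, ...] turns [1] into
    Koszul elements [z k] of degree [k] that are cycles modulo [s`_0 .. s`_(k-1)].
    With more than [c] elements some [z k] vanishes, and regularity carries this
    back step by step to [z 0 = 1], which would have to be a Koszul boundary. *)
Lemma regular_seq_size_le (s : seq R) x c :
    regular_seq s -> 1 \notin ideal_seq (mkseq x c) ->
    {subset s <= ideal_seq (mkseq x c)} -> (size s <= c)%N.
Proof.
move=> /regular_seqP[reg _] x1 sx; rewrite leqNgt; apply/negP=> lt_c.
have coef i : exists a : nat -> R, (i < size s)%N ->
  s`_i = \sum_(k < c) a k * x k.
  have [lt_i|_] := boolP (i < size s)%N; last by exists (fun=> 0).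
  have /ideal_seqP := sx _ (mem_nth 0 lt_i).
  rewrite size_mkseq => -[a ->].
  exists (fun k => if insub k is Some l then a l else 0) => _.
  by apply: eq_bigr => k _; rewrite valK nth_mkseq.
have {coef} [a sa] := boolp.choice coef.
pose z := fix z k : kos c := if k is k'.+1 then kos_mul (a k') (z k') else
  kos_cst 1 c.
have diff_z k : (k < size s)%N ->
    exists2 v : kos c, kos_in (ideal_seq (take k s)) v
                     & kos_diff x (z k.+1) = s`_k *: z k - v.
  elim: k => [|k IH] lt_k.
    exists 0; first exact: kos_in0.
    have := kos_homotopy x (a 0%N) (z 0%N).
    have -> : kos_diff x (z 0%N) = 0.
      rewrite /=; elim: (c) => [|d IHd] //=.
      by rewrite IHd kos_diff0 scaler0 addr0 oppr0.
    by rewrite kos_mul0 addr0 subr0 -sa.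
  have [v vJ dz] := IH (ltnW lt_k).
  exists (kos_mul (a k.+1) (s`_k *: z k - v)).
    apply: kos_in_mul; rewrite (take_nth 0) ?(ltnW lt_k) //; apply: kos_inB.
      (* the coordinates of s`_k *: z k are multiples of s`_k *)
      elim: (c) (z k) => [|d IHd] w /=; last by split; apply: IHd.
      by apply: idealMr; apply: mem_ideal_seq; rewrite mem_rcons mem_head.
    apply: kos_inS vJ; apply: ideal_seq_sub => y ys.
    by apply: mem_ideal_seq; rewrite mem_rcons in_cons ys orbT.
  by rewrite (sa k.+1) // -kos_homotopy -dz addrK.
have deg_z k : kos_deg_ge k (z k).
  by elim: k => [|k IH]; [apply: kos_deg_ge0|apply: kos_deg_ge_mul].
have bd k : (k <= size s)%N ->
    (exists v y, kos_in (ideal_seq (take k s)) v /\ z k = v + kos_diff x y) ->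
    exists y, z 0%N = kos_diff x y.
  elim: k => [|k IH] le_k.
    rewrite take0 => -[v [y [v0 ->]]]; exists y.
    suff -> : v = 0 by rewrite add0r.
    elim: (c) v v0 {y} => [|d IHd] /= v; first exact: ideal_seq_nil.
    by case: v => v1 v2 /= [/IHd-> /IHd->].
  move=> [v [y [vJ zk]]]; apply: IH; first exact: ltnW.
  have [u uJ dz] := diff_z k le_k.
  move: vJ; rewrite (take_nth 0) // => /kos_in_rcons[v' [w [v'J v_eq]]].
  exists (z k - kos_diff x w), w; split; last by rewrite subrK.
  apply: (kos_in_reg (reg k le_k)); rewrite scalerBr -kos_diffZ.
  have -> : s`_k *: z k = kos_diff x (z k.+1) + u by rewrite dz subrK.
  rewrite zk v_eq !kos_diffD kos_diff_diff addr0 addrAC addrK.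
  by apply: kos_inD => //; apply: kos_in_diff.
have [|y z0] := bd c.+1 lt_c.
  exists 0, 0; split; first exact: kos_in0.
  by rewrite kos_diff0 addr0; apply: kos_deg_gt.
have /negP := x1; apply; rewrite -(kos_aug_cst 1 c) -[kos_cst 1 c]/(z 0%N) z0.
apply: kos_aug_diff => i lt_i.
by apply: mem_ideal_seq; apply/mapP; exists i; rewrite ?mem_iota.
Qed.

End Koszul.

(** * Invariance of Fitting ideals *)

Section Minors.
Variable R : comNzRingType.

(** Multilinearity in the rows: the Cauchy-Binet formula before the terms with
    the same set of rows are collected. *)
Lemma det_mulmx_expand t m (A : 'M[R]_(t, m)) (B : 'M[R]_(m, t)) :
  \det (A *m B) =
  \sum_(h : {ffun 'I_t -> 'I_m}) (\prod_i A i (h i)) * \det (rowsub h B).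
Proof.
under [RHS]eq_bigr do rewrite /determinant big_distrr /=.
rewrite exchange_big /=; apply: eq_bigr => s _.
under [RHS]eq_bigr do rewrite mulrCA.
rewrite -big_distrr /=; congr (_ * _).
under eq_bigr do rewrite mxE.
rewrite (bigA_distr_bigA (fun i k => A i k * B k (s i))) /=.
apply: eq_bigr => h _; rewrite big_split; congr (_ * _).
by apply: eq_bigr => i _; rewrite mxE.
Qed.

Lemma perm_sorting t m (f : 'I_t -> 'I_m) : injective f ->
  exists s : 'S_t, {homo f \o s : i j / (i < j)%N}.
Proof.
move=> f_inj; pose le_f (i j : 'I_t) := (f i <= f j)%N.
have le_tot : total le_f by move=> i j; apply: leq_total.
have le_tr : transitive le_f by move=> i j k; apply: leq_trans.
pose l := sort le_f (enum 'I_t).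
have size_l : size l = t by rewrite size_sort size_enum_ord.
have l_uniq : uniq l by rewrite sort_uniq enum_uniq.
pose s0 (i : 'I_t) := nth i l i.
have s0_inj : injective s0.
  move=> i j; rewrite /s0 (set_nth_default i) ?size_l // => /eqP.
  by rewrite nth_uniq ?size_l // => /eqP/val_inj.
exists (perm s0_inj) => i j lt_ij /=; rewrite !permE ltn_neqAle.
apply/andP; split.
  by apply: contraTneq lt_ij => /val_inj/f_inj/s0_inj->; rewrite ltnn.
rewrite /s0 (@set_nth_default _ l i j j) ?size_l //.
apply: (sorted_leq_nth le_tr _ i (sort_sorted le_tot _)) => //.
- by move=> k; apply: leqnn.
- by rewrite inE size_l.
- by rewrite inE size_l.
- exact: ltnW.
Qed.

(** Repeated rows or columns give a zero minor, and sorting them changes the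
    sign at most, so that rows and columns may be chosen by arbitrary maps. *)
Lemma minor_mem t m r (A : 'M[R]_(m, r)) (f : 'I_t -> 'I_m) (g : 'I_t -> 'I_r) :
  \det (mxsub f g A) \in minors_ideal t A.
Proof.
have [/injectiveP f_inj|/injectivePn[i [j nij fij]]] := boolP (injectiveb f);
  last first.
  rewrite (determinant_alternate nij); first exact: ideal0.
  by move=> k; rewrite !mxE fij.
have [/injectiveP g_inj|/injectivePn[i [j nij gij]]] := boolP (injectiveb g);
  last first.
  rewrite -det_tr (determinant_alternate nij); first exact: ideal0.
  by move=> k; rewrite !mxE gij.
have [s fs] := perm_sorting f_inj; have [s' gs'] := perm_sorting g_inj.
have -> : mxsub f g A = perm_mx s^-1 *m (mxsub (f \o s) (g \o s') A) *m perm_mx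
  s'.
  rewrite -row_permE -[s' in perm_mx s']invgK -col_permE.
  by apply/matrixP=> i j; rewrite !mxE /= !permKV.
rewrite !det_mulmx; apply: idealMr; apply: idealMl.
by apply: mem_ideal_gen; exists (f \o s), (g \o s').
Qed.

Lemma minors_idealP m r t (A : 'M[R]_(m, r)) (J : idealOf R) :
  (forall (f : 'I_t -> 'I_m) (g : 'I_t -> 'I_r), \det (mxsub f g A) \in J) ->
  {subset minors_ideal t A <= J}.
Proof.
by move=> AJ; apply: (proj1 (ideal_genP _ _)) => x [f [g [_ _ ->]]].
Qed.

Lemma minors_idealS m r t t' (A : 'M[R]_(m, r)) :
  (t' <= t)%N -> {subset minors_ideal t A <= minors_ideal t' A}.
Proof.
move=> /subnK <-; elim: (t - t')%N => [|k IH] //.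
rewrite addSn; apply: minors_idealP => f g.
rewrite (expand_det_row _ ord0); apply: ideal_sum => j _; apply: idealMl.
rewrite /cofactor; apply: idealMl; apply: IH.
rewrite (_ : row' _ _ = mxsub (f \o lift ord0) (g \o lift j) A);
  first exact: minor_mem.
by apply/matrixP=> a b; rewrite !mxE.
Qed.

(** Laplace expansion along the [#|E|] rows that do not come from [A]. *)
Lemma det_extra_rows m r (A : 'M[R]_(m, r)) k s (N : 'M[R]_s) (g : 'I_s -> 'I_r)
    (E : {set 'I_s}) :
  (#|E| <= k)%N ->
  (forall i, i \notin E -> exists a, forall j, N i j = A a (g j)) ->
  \det N \in minors_ideal (s - k) A.
Proof.
elim: s k N g E => [|s IH] k N g E leEk rowN.
  apply: (minors_idealS (leq0n _)).
  have f (i : 'I_0) : 'I_m by case: i.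
  rewrite (_ : N = mxsub f g A); first exact: minor_mem.
  by apply/matrixP=> i; have := ltn_ord i.
have [E0|[i0 i0E]] := set_0Vmem E.
  have {}rowN i : exists a, forall j, N i j = A a (g j) by apply: rowN;
    rewrite E0 inE.
  have [f Nf] := boolp.choice rowN.
  apply: (minors_idealS (leq_subr k _)).
  rewrite (_ : N = mxsub f g A); first exact: minor_mem.
  by apply/matrixP=> i j; rewrite !mxE.
case: k leEk => [|k leEk]; first by rewrite leqn0 cards_eq0 => /eqP E0;
  rewrite E0 inE in i0E.
rewrite (expand_det_row _ i0); apply: ideal_sum => j _; apply: idealMl.
rewrite /cofactor; apply: idealMl; rewrite subSS.
apply: (IH k _ (g \o lift j) (lift i0 @^-1: E)) => [|i].
  rewrite -ltnS; apply: leq_trans leEk; rewrite (cardsD1 i0) i0E add1n ltnS.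
  rewrite -(card_imset _ (@lift_inj _ i0)); apply: subset_leq_card.
  apply/subsetP=> _ /imsetP[i iE ->].
  by move: iE; rewrite !inE eq_sym neq_lift => ->.
rewrite inE => /rowN[a Na]; exists a => l; rewrite !mxE /=.
exact: Na.
Qed.

End Minors.

Section FittingInvariance.
Variables (R : comNzRingType) (M : lmodType R).

(** Fitting's lemma. Lifting the generators of each presentation through the
    other one gives [C] and [C'], and the matrix [B] of the relations [A'] and
    [e - e C] on the union of the two sets of generators. Bordering a minor of
    [A] by the relations [e - e C'] does not change it, and the bordered matrix is
    a multiple of [B], because [B] contains all relations on the union. Its minors
    are then reduced to minors of [A'] by removing the [r] extra rows. *)
Lemma presents_minors_sub m r (A : 'M[R]_(m, r)) m' r' (A' : 'M[R]_(m', r')) j :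
  presents M A -> presents M A' ->
  {subset minors_ideal (r - j) A <= minors_ideal (r' - j) A'}.
Proof.
move=> [phi [phi_surj phi_ker]] [phi' [phi'_surj phi'_ker]].
have lift_mx p q (h : {linear 'rV[R]_p -> M}) (h' : {linear 'rV[R]_q -> M}) :
    (forall x, exists u, h' u = x) ->
    exists C : 'M[R]_(p, q), forall v, h v = h' (v *m C).
  move=> h'_surj; have [c hc] :=
    boolp.choice (fun i => h'_surj (h (delta_mx 0 i))).
  exists (\matrix_i c i) => v.
  rewrite mulmx_sum_row linear_sum /= {1}(row_sum_delta v) linear_sum /=.
  by apply: eq_bigr => i _; rewrite !linearZ /= rowK hc.
have [C phiC] := lift_mx _ _ phi phi' phi'_surj.
have [C' phiC'] := lift_mx _ _ phi' phi phi_surj.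
have factor p (N : 'M[R]_(p, r')) : (forall i, phi' (row i N) = 0) ->
    exists Y, N = Y *m A'.
  move=> N0; have /boolp.choice[y Ny] : forall i, exists y, row i N = y *m A'.
    by move=> i; apply/phi'_ker.
  exists (\matrix_i y i); apply/row_matrixP => i.
  by rewrite row_mul rowK.
have [Y ACY] : exists Y, A *m C = Y *m A'.
  apply: factor => i; rewrite row_mul -phiC; apply/phi_ker.
  by exists (delta_mx 0 i); rewrite -rowE.
have [Y' CCY'] : exists Y, 1%:M - C' *m C = Y *m A'.
  apply: factor => i; rewrite raddfB /= row_mul linearB /= -phiC phiC'.
  by rewrite -row_mul mul1mx subrr.
apply: minors_idealP => f g.
set t := (r - j)%N in f g *.
pose B := block_mx 0 A' 1%:M (- C) : 'M_(m' + r, r + r').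
pose X := col_mx (rowsub f (row_mx Y A)) (row_mx Y' (- C')).
pose gg (k : 'I_(t + r')) : 'I_(r + r') :=
  match split k with inl a => lshift r' (g a) | inr b => rshift r b end.
(* the minor of A, bordered by an identity block *)
have -> : \det (mxsub f g A) = \det (X *m colsub gg B).
  rewrite (_ : X *m _ = block_mx (mxsub f g A) 0 (colsub g (- C')) 1%:M).
    by rewrite det_lblock det1 mulr1.
  rewrite -[X *m _]/(X *m mxsub id gg B).
  have -> : X *m mxsub id gg B = mxsub id gg (X *m B).
    apply/matrixP=> a b; rewrite !mxE; apply: eq_bigr => c _.
    by rewrite [mxsub _ _ _ _ _]mxE.
  have -> : X *m B = block_mx (rowsub f A) 0 (- C') 1%:M.
    rewrite /X /B mul_col_mx block_mxEv; congr col_mx; last first.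
      by rewrite mul_row_block mulmx0 add0r mulmx1 mulmxN mulNmx opprK -CCY'
        subrK.
    have -> : rowsub f (row_mx Y A) = row_mx (rowsub f Y) (rowsub f A).
      by apply/matrixP=> a b; rewrite !mxE; case: (split b) => c; rewrite mxE.
    rewrite mul_row_block mulmx0 add0r mulmx1 mulmxN; congr row_mx.
    by rewrite !mul_rowsub_mx ACY subrr.
  have gg_l b : gg (lshift r' b) = lshift r' (g b).
    by rewrite /gg (unsplitK (inl _)).
  have gg_r b : gg (rshift t b) = rshift r b by rewrite /gg (unsplitK (inr _)).
  apply/matrixP=> a b; rewrite [LHS]mxE.
  case: (split_ordP a) => a' ->; case: (split_ordP b) => b' ->;
    rewrite ?gg_l ?gg_r.
  - by rewrite !block_mxEul !mxE.
  - by rewrite !block_mxEur !mxE.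
  - by rewrite !block_mxEdl !mxE.
  - by rewrite !block_mxEdr !mxE.
suff key (h : 'I_(t + r') -> 'I_(m' + r)) :
    \det (rowsub h (colsub gg B)) \in minors_ideal (r' - j) A'.
  by rewrite det_mulmx_expand; apply: ideal_sum => h _; apply: idealMl;
    apply: key.
have le_t : (r' - j <= t + r' - r)%N by rewrite /t; lia.
apply: (minors_idealS le_t).
have sub0 : {subset minors_ideal (t + r' - r) (row_mx 0 A' : 'M_(m', r + r'))
               <= minors_ideal (t + r' - r) A'}.
  apply: minors_idealP => f' g'.
  have [[l [b g'l]]|allr] := EM (exists l b, g' l = lshift r' b).
    rewrite (expand_det_col _ l) big1 ?ideal0 // => i _.
    by rewrite [mxsub _ _ _ _ _]mxE g'l row_mxEl mxE mul0r.
  have /boolp.choice[g2 g'2] : forall l, exists b, g' l = rshift r b.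
    move=> l; case: (split_ordP (g' l)) => b g'l; last by exists b.
    by case: allr; exists l, b.
  rewrite (_ : mxsub _ _ _ = mxsub f' g2 A'); first exact: minor_mem.
  by apply/matrixP=> a b; rewrite [LHS]mxE [RHS]mxE g'2 row_mxEr.
apply: sub0.
have [/injectiveP h_inj|/injectivePn[i1 [i2 ni hi]]] := boolP (injectiveb h);
  last first.
  rewrite (determinant_alternate ni); first exact: ideal0.
  by move=> k; rewrite !mxE hi.
apply: (det_extra_rows (g := gg) (E := [set i | (m' <= h i)%N])) => [|i].
  rewrite -(card_imset _ h_inj) -[X in (_ <= X)%N]card_ord.
  rewrite -(card_imset _ (@rshift_inj m' r)); apply: subset_leq_card.
  apply/subsetP=> _ /imsetP[i + ->]; rewrite inE.
  case: (split_ordP (h i)) => b -> /=; first by rewrite leqNgt ltn_ord.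
  by move=> _; rewrite imset_f.
rewrite inE -ltnNge; case: (split_ordP (h i)) => // a hi _.
by exists a => l; rewrite [LHS]mxE hi [mxsub _ _ _ _ _]mxE /B block_mxEv
  col_mxEu.
Qed.

Lemma Fitt_presents m r (A : 'M[R]_(m, r)) j :
  presents M A -> Fitt j M =i minors_ideal (r - j) A.
Proof.
move=> MA; rewrite /Fitt; set A0 := choose_presentation M.
have MA0 : presents M (tagged A0).
  apply: (@classical_sets.xgetPex _ _ (fun A : {mr & matrix_of_dims R mr} =>
    presents M (tagged A))).
  by exists (Tagged (@matrix_of_dims R) (A : matrix_of_dims R (m, r))).
by move=> x; apply/idP/idP; apply: presents_minors_sub.
Qed.

End FittingInvariance.

(** * Monomial ideals *)

Section Monomials.
Variables (K : fieldType) (n : nat).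
Implicit Types (A B U : {set 'I_n}) (m : 'X_{1..n}) (f : {mpoly K[n]}).

(** The exponent of the squarefree monomial with support [A]. *)
Definition smon A : 'X_{1..n} := [multinom (i \in A : nat) | i < n].

Lemma smonE A i : smon A i = (i \in A).
Proof. exact: mnmE. Qed.

Lemma smon_le A m : (smon A <= m)%MM = (A \subset [set i | m i != 0%N]).
Proof.
apply/mnm_lepP/subsetP => [le_m i iA|sub_m i]; last first.
  by rewrite smonE; case: (boolP (i \in A)) => // /sub_m; rewrite inE lt0n.
by rewrite inE -lt0n; have := le_m i; rewrite smonE iA.
Qed.

Lemma smon_leS A B : (smon A <= smon B)%MM = (A \subset B).
Proof.
rewrite smon_le (_ : [set i | _] = B) //.
by apply/setP=> i; rewrite inE smonE; case: (i \in B).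
Qed.

Lemma smonDU A B : (smon (B :\: A) + smon A)%MM = smon (A :|: B).
Proof.
apply/mnmP => i; rewrite mnmDE !smonE !inE.
by case: (i \in A); rewrite ?addn0.
Qed.

Lemma mpolyX_neq0 m : 'X_[K, m] != 0.
Proof. by rewrite -msupp_eq0 msuppX. Qed.

Lemma mpolyX_dvd m m' : (m <= m')%MM -> 'X_[K, m'] = 'X_[m' - m] * 'X_[m].
Proof. by move=> le_m; rewrite -mpolyXD submK. Qed.

Definition monomial_ideal (G : 'X_{1..n} -> Prop) : idealOf {mpoly K[n]} :=
  ideal_gen (fun p => exists2 m, G m & p = 'X_[K, m]).

(** Membership in a monomial ideal can be tested monomial by monomial, since a
    combination of generators only has monomials that are multiples of these. *)
Lemma mem_monomial_ideal (G : 'X_{1..n} -> Prop) f :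
  f \in monomial_ideal G <->
  (forall m, m \in msupp f -> exists2 m0, G m0 & (m0 <= m)%MM).
Proof.
split=> [/asboolP[k [a [g [Gg ->]]]] m /msupp_sum_le/flattenP[/= _ /mapP[i _
  ->]]|Gf].
  have [m0 Gm0 ->] := Gg i.
  by rewrite (perm_mem (msuppMX _ _)) => /mapP[m' _ ->]; exists m0;
    rewrite ?lem_addr.
rewrite [f]mpolyE big_seq; apply: ideal_sum => m /Gf[m0 Gm0 le_m].
rewrite (mpolyX_dvd le_m) scalerAl; apply: idealMl.
by apply: mem_ideal_gen; exists m0.
Qed.

Lemma monomial_in_ideal (G : 'X_{1..n} -> Prop) m :
  'X_[m] \in monomial_ideal G <-> exists2 m0, G m0 & (m0 <= m)%MM.
Proof.
rewrite mem_monomial_ideal; split=> [|Gm m']; last by move/mem_msuppXP<-.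
by apply; apply/mem_msuppXP.
Qed.

End Monomials.

Arguments smon {n} A.

Section Families.
Variables (K : fieldType) (n r : nat) (u : 'I_r -> {set 'I_n}).
Local Notation S := {mpoly K[n]}.
Implicit Types (v w : 'rV[S]_r) (a b p l : 'I_r).

Definition sqfree_gen a : S := 'X_[smon (u a)].

Definition sqfree_ideal : idealOf S :=
  monomial_ideal K (fun m => exists a, m = smon (u a)).

(** The least common multiple of the generators [a] and [b], divided by [a]. *)
Definition taylor_coef a b : S := 'X_[smon (u b :\: u a)].

Definition taylor_row a b : 'rV[S]_r :=
  taylor_coef a b *: delta_mx 0 a - taylor_coef b a *: delta_mx 0 b.

Definition syz v := \sum_a v 0 a * sqfree_gen a.

Lemma sqfree_gen_neq0 a : sqfree_gen a != 0.
Proof. exact: mpolyX_neq0. Qed.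

Lemma taylor_coefM a b : taylor_coef a b * sqfree_gen a = 'X_[smon (u a :|: u
  b)].
Proof. by rewrite -mpolyXD smonDU. Qed.

Lemma syzD v w : syz (v + w) = syz v + syz w.
Proof. by rewrite -big_split; apply: eq_bigr => a _; rewrite mxE mulrDl. Qed.

Lemma syzZ c v : syz (c *: v) = c * syz v.
Proof. by rewrite [RHS]big_distrr /=; apply: eq_bigr => a _;
  rewrite mxE mulrA. Qed.

Lemma syzB v w : syz (v - w) = syz v - syz w.
Proof. by rewrite syzD -(scaleN1r w) syzZ mulN1r. Qed.

Lemma syz_sum (I : Type) (s : seq I) (P : pred I) (F : I -> 'rV_r) :
  syz (\sum_(i <- s | P i) F i) = \sum_(i <- s | P i) syz (F i).
Proof.
apply: (big_morph syz syzD).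
by rewrite [LHS]big1 // => a _; rewrite mxE mul0r.
Qed.

Lemma syz_delta a : syz (delta_mx 0 a) = sqfree_gen a.
Proof.
rewrite [LHS](bigD1 a) //= mxE !eqxx mul1r big1 ?addr0 // => b nab.
by rewrite mxE (negPf nab) andbF mul0r.
Qed.

Lemma syz_taylor a b : syz (taylor_row a b) = 0.
Proof. by rewrite syzB !syzZ !syz_delta !taylor_coefM setUC subrr. Qed.

Lemma taylor_row_in a b : a != b -> taylor_row a b 0 a = taylor_coef a b.
Proof. by move=> nab; rewrite !mxE !eqxx (negPf nab) andbF mulr1 mulr0 subr0.
  Qed.

Lemma taylor_row_out a b c : c != a -> c != b -> taylor_row a b 0 c = 0.
Proof. by move=> /negPf nca /negPf ncb;
  rewrite !mxE nca ncb !andbF !mulr0 subr0. Qed.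

Lemma taylor_rowN a b : taylor_row a b = - taylor_row b a.
Proof. by rewrite opprB. Qed.

Lemma mem_sqfree_ideal (f : S) :
  f \in sqfree_ideal <-> (forall m, m \in msupp f -> exists a,
    (smon (u a) <= m)%MM).
Proof.
rewrite mem_monomial_ideal; split=> sf m /sf; first by case=> _ [a ->];
  exists a.
by case=> a le_m; exists (smon (u a)); first by exists a.
Qed.

Lemma sqfree_gen_mem a : sqfree_gen a \in sqfree_ideal.
Proof. by apply/mem_sqfree_ideal => m; rewrite msuppX inE => /eqP->; exists a;
  apply: lepm_refl. Qed.

(** The coefficient of [l] in a relation lies in the colon ideal of the other
    generators by [l], and a monomial ideal has a monomial colon ideal. *)
Lemma syz_colon v l : syz v = 0 ->
  exists c : 'I_r -> S,
    v 0 l = \sum_(a | (a != l) && (v 0 a != 0)) c a * taylor_coef l a.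
Proof.
rewrite /syz (bigD1 l) //= => /eqP; rewrite addr_eq0 => /eqP vl.
pose G m := exists2 a, (a != l) && (v 0 a != 0) & m = smon (u a :\: u l).
have : v 0 l \in monomial_ideal K G.
  apply/mem_monomial_ideal => m;
    rewrite mcoeff_msupp -(mcoeffMX _ (smon (u l))) vl.
  rewrite mcoeffN oppr_eq0 raddf_sum /= => nz.
  have [a /andP[nal nz_a]] : exists a, (a != l) &&
      ((v 0 a * sqfree_gen a)@_(smon (u l) + m) != 0).
    apply/existsP; apply: contraNT nz; rewrite negb_exists => /forallP z.
    apply/eqP; apply: big1 => a nal; apply/eqP.
    by have := z a; rewrite nal negbK.
  have va : v 0 a != 0 by apply: contraNneq nz_a => ->; rewrite mul0r mcoeff0.
  exists (smon (u a :\: u l)); first by exists a; rewrite ?nal.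
  move: nz_a; rewrite -mcoeff_msupp (perm_mem (msuppMX _ _)) =>
    /mapP[m' _ eq_m].
  apply/mnm_lepP => i; rewrite smonE inE; case: (boolP (i \in u l)) => //= il.
  have /mnmP/(_ i) := eq_m; rewrite !mnmDE !smonE (negPf il) add0n => ->.
  exact: leq_addr.
move=> /asboolP[k [b [g [Gg ->]]]].
have /boolp.choice[h gh] : forall i, exists a,
    (a != l) && (v 0 a != 0) /\ g i = taylor_coef l a.
  by move=> i; have [_ [a Pa ->] ->] := Gg i; exists a.
exists (fun a => \sum_(i < k | h i == a) b i).
under [RHS]eq_bigr do rewrite big_distrl /=.
rewrite (exchange_big_dep predT) //=; apply: eq_bigr => i _.
have [Ph ->] := gh i.
rewrite (big_pred1 (h i)) // => a /=.
by case: (eqVneq (h i) a) => [<-|nha]; rewrite ?Ph ?eqxx ?andbF.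
Qed.

(** Elimination of the generators one at a time, the last in the order [d]
    first: the coefficient of the last one lies in the colon ideal of the
    others, and the relations that are assumed to be in [Q] generate it. *)
Lemma syz_elimination (Q : 'rV[S]_r -> Prop) (d : 'I_r -> nat) :
  Q 0 -> (forall c v w, Q v -> Q w -> Q (c *: v + w)) -> injective d ->
  (forall l a, (d a < d l)%N -> exists p,
     [/\ (d p < d l)%N, Q (taylor_row l p) & u p :\: u l \subset u a :\: u l])
       ->
  forall v, syz v = 0 -> Q v.
Proof.
move=> Q0 Qlin d_inj next v.
have [k v_supp] : exists k, forall a, v 0 a != 0 -> (d a < k)%N.
  by exists (\max_a d a).+1 => a _; rewrite ltnS leq_bigmax.
elim: k v v_supp => [|k IH] v v_supp v_syz.
  suff -> : v = 0 by [].
  apply/rowP => a; rewrite mxE; apply/eqP; apply: contraT => /v_supp.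
  by rewrite ltn0.
have [[l dl]|nok] := EM (exists l, d l = k); last first.
  apply: IH => // a va; have := v_supp a va; rewrite ltnS leq_eqVlt.
  by case/predU1P=> // da; case: nok; exists a.
have before a : (a != l) && (v 0 a != 0) -> (d a < d l)%N.
  case/andP=> nal /v_supp; rewrite ltnS leq_eqVlt -dl =>
    /predU1P[/d_inj eq_al|//].
  by rewrite eq_al eqxx in nal.
have [c vl] := syz_colon l v_syz.
have /boolp.choice[p pP] : forall a, exists p, (d a < d l)%N ->
     [/\ (d p < d l)%N, Q (taylor_row l p) & u p :\: u l \subset u a :\: u l].
  move=> a; have [lt_a|_] := boolP (d a < d l)%N; last by exists a.
  by have [p ?] := next l a lt_a; exists p.
pose y a := c a * 'X_[smon (u a :\: u l) - smon (u (p a) :\: u l)].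
pose w := \sum_(a | (a != l) && (v 0 a != 0)) y a *: taylor_row l (p a).
have Qw : Q w.
  rewrite /w; elim/big_rec: _ => // a x Pa Qx; apply: Qlin => //.
  by case: (pP a (before a Pa)).
suff : Q (v - w).
  by move=> Qvw; rewrite -(subrK w v) -[v - w]scale1r; apply: Qlin.
apply: IH; last first.
  rewrite syzB v_syz syz_sum big1 ?subrr // => a _.
  by rewrite syzZ syz_taylor mulr0.
move=> a; rewrite -dl; apply: contraNT; rewrite -leqNgt => le_a; apply/eqP.
have [->|nal] := eqVneq a l.
  rewrite mxE [(- w) 0 l]mxE summxE vl; apply/eqP; rewrite subr_eq0; apply/eqP.
  apply: eq_bigr => b Pb; have [lt_p _ sub_p] := pP b (before b Pb).
  rewrite mxE taylor_row_in; last by apply: contraTneq lt_p => ->; rewrite ltnn.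
  by rewrite /y -mulrA -mpolyXD submK // smon_leS.
have va0 : v 0 a = 0.
  apply/eqP; apply: contraT => va; have := before a; rewrite nal va => /(_ isT).
  by rewrite ltnNge le_a.
rewrite mxE [(- w) 0 a]mxE summxE va0 big1 ?subr0 // => b Pb.
have [lt_p _ _] := pP b (before b Pb).
rewrite mxE taylor_row_out ?mulr0 //.
by apply: contraTneq lt_p => <-; rewrite -leqNgt.
Qed.

Lemma syz_taylor_span (Q : 'rV[S]_r -> Prop) :
  Q 0 -> (forall c v w, Q v -> Q w -> Q (c *: v + w)) ->
  (forall a b, Q (taylor_row a b)) -> forall v, syz v = 0 -> Q v.
Proof.
move=> Q0 Qlin Qt; apply: (@syz_elimination Q (@nat_of_ord r)) => //.
  exact: val_inj.
by move=> l a lt_a; exists a.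
Qed.

End Families.

(** * Linear maps out of free modules *)

Section FreeMaps.
Variables (R : comNzRingType) (V : lmodType R) (m : nat) (w : 'I_m -> V).

Definition free_map (v : 'rV[R]_m) : V := \sum_i v 0 i *: w i.

Lemma free_map_linear : linear free_map.
Proof.
move=> c v v'; rewrite /free_map scaler_sumr -big_split;
  apply: eq_bigr => i _ /=.
by rewrite !mxE scalerDl scalerA.
Qed.

HB.instance Definition _ := GRing.isLinear.Build R 'rV[R]_m V *:%R free_map
  free_map_linear.

End FreeMaps.

(** * Rooted forests and the minors of the Taylor relations *)

Section Forests.
Variables (K : fieldType) (n r : nat) (u : 'I_r -> {set 'I_n}).
Local Notation S := {mpoly K[n]}.
Local Notation gen := (sqfree_gen K u).
Local Notation trow := (taylor_row K u).
Local Notation tcoef := (taylor_coef K u).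
Implicit Types (C : {set 'I_r}) (s : seq ('I_r * 'I_r)).

(** A spanning forest with set of roots [C], as the list of its edges (child,
    parent) in an order in which each parent is reached before its children. *)
Fixpoint spanning_forest C s : bool :=
  if s is vp :: s' then
    [&& vp.2 \in C, vp.1 \notin C & spanning_forest (vp.1 |: C) s']
  else C == setT.

Definition edge_loss (e : 'I_r * 'I_r) : {set 'I_n} := u e.2 :\: u e.1.

Definition forest_exp s : 'X_{1..n} := (\sum_(e <- s) smon (edge_loss e))%MM.

Lemma spanning_forest_size C s : spanning_forest C s -> (size s + #|C| = r)%N.
Proof.
elim: s C => [|e s IH] C /=; first by move=> /eqP->; rewrite cardsT card_ord.
by case/and3P=> _ eC /IH; rewrite cardsU1 eC addnA addn1.
Qed.

Lemma spanning_forest_child C s : spanning_forest C s ->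
  forall e, e \in s -> e.1 \notin C.
Proof.
elim: s C => [|e s IH] C //= /and3P[_ eC /IH sC] e';
  rewrite inE => /predU1P[->//|].
by move/sC; rewrite !inE negb_or => /andP[].
Qed.

Lemma spanning_forest_ind (P : 'I_r -> Prop) C s : spanning_forest C s ->
  (forall c, c \in C -> P c) -> (forall e, e \in s -> P e.2 -> P e.1) ->
  forall v, P v.
Proof.
elim: s C => [|e s IH] C /=; first by move=> /eqP-> PC _ v; apply: PC;
  rewrite inE.
case/and3P=> eC _ sC PC Ps; apply: (IH _ sC) => [c|e' e's].
  rewrite !inE => /predU1P[->|/PC//]; apply: Ps; first by rewrite mem_head.
  exact: PC.
by apply: Ps; rewrite inE e's orbT.
Qed.

Definition edge_minor t (e : 'I_t -> 'I_r * 'I_r) (g : 'I_t -> 'I_r) :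
    'M[S]_t :=
  \matrix_(k, l) trow (e k).1 (e k).2 0 (g l).

Lemma edge_minor_minor t (e : 'I_t.+1 -> 'I_r * 'I_r)
    (g : 'I_t.+1 -> 'I_r) k l :
  row' k (col' l (edge_minor e g)) = edge_minor (e \o lift k) (g \o lift l).
Proof. by apply/matrixP=> a b; rewrite !mxE. Qed.

(** In the order of the list the minor is lower triangular: an edge has entries
    only in the columns of its child and of its parent, a root or earlier child. *)
Lemma forest_minor C s : spanning_forest C s ->
  \det (edge_minor (tnth (in_tuple s)) (fun l => (tnth (in_tuple s) l).1)) =
  'X_[forest_exp s].
Proof.
elim: s C => [|e s IH] C /=; first by rewrite det_mx00 /forest_exp big_nil
  mpolyX0.
move=> /[dup] sC0 /and3P[e2 e1 sC].
rewrite (expand_det_row _ ord0) big_ord_recl big1 ?addr0 => [|l _]; last first.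
  rewrite mxE !(tnth_nth e) /=; set v := (nth e s l).
  have vs : v \in s by apply: mem_nth.
  have := spanning_forest_child sC vs.
  rewrite !inE negb_or => /andP[ne1 nC]; rewrite taylor_row_out ?mul0r //.
  by apply: contraNneq nC => ->.
rewrite mxE !(tnth_nth e) /= taylor_row_in; last first.
  by apply: contraNneq e1 => ->.
rewrite /cofactor expr0 mul1r edge_minor_minor /forest_exp big_cons mpolyXD.
congr (_ * _); rewrite -(IH _ sC); congr (\det _).
by apply/matrixP=> a b; rewrite !mxE /= !(tnth_nth e) /=.
Qed.

(** Matrix-tree phenomenon: up to sign a minor of Taylor relations is [0] or
    the monomial of a forest rooted at the omitted generators. If no row has
    exactly one end among the columns, the generators themselves form a nonzero
    kernel vector; otherwise such a row has a single nonzero entry, and the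
    expansion along it makes its end in the columns a new root. The equation of
    exponents records that all these minors are homogeneous in the fine grading. *)
Lemma edge_minor_forest t (e : 'I_t -> 'I_r * 'I_r) (g : 'I_t -> 'I_r) :
  injective g ->
  \det (edge_minor e g) = 0 \/
  exists s (b : bool), [/\ spanning_forest (~: [set g l | l : 'I_t]) s,
    \det (edge_minor e g) = (-1) ^+ b * 'X_[forest_exp s] &
    (forest_exp s + \sum_l smon (u (g l)) =
     \sum_k smon (u (e k).1 :|: u (e k).2))%MM].
Proof.
elim: t e g => [|t IH] e g g_inj.
  right; exists [::], false; split;
    last by rewrite /forest_exp !big_ord0 big_nil addm0.
    by apply/eqP/setP=> x; rewrite !inE; apply/imsetP=> -[[]].
  by rewrite det_mx00 expr0 mul1r /forest_exp big_nil mpolyX0.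
pose im := [set g l | l : 'I_t.+1].
have [/forallP noend|] := boolP [forall k,
  ((e k).1 \in im) == ((e k).2 \in im)].
  left; set N := edge_minor e g.
  have NU : N *m (\col_l gen (g l)) = 0.
    apply/matrixP=> k z; rewrite !mxE; have /eqP := noend k.
    case ek: (e k) => [a b] /= ab.
    have -> : \sum_l N k l * (\col_l gen (g l)) l z =
              \sum_(c in im) trow a b 0 c * gen c.
      by rewrite big_imset /=; [apply: eq_bigr => l _;
        rewrite !mxE ek|move=> ? ? _ _ /g_inj].
    have sum_delta d (X : S) : \sum_(c in im) (c == d)%:R * X = (d \in im)%:R *
      X.
      case: (boolP (d \in im)) => dim; last first.
        rewrite mul0r big1 // => c cim; rewrite (_ : c == d = false) ?mul0r //.
        by apply: contraNF dim => /eqP<-.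
      rewrite (bigD1 d) //= eqxx big1 ?addr0 // => c /andP[_ /negPf->].
      by rewrite mul0r.
    rewrite (eq_bigr (fun c => (c == a)%:R * 'X_[smon (u a :|: u b)]
                             - (c == b)%:R * 'X_[smon (u a :|: u b)])) =>
                               [|c _].
      by rewrite sumrB !sum_delta ab subrr.
    rewrite !mxE /= mulrBl; congr (_ - _).
      by case: (eqVneq c a) => [->|_] /=;
        rewrite ?mulr0 ?mul0r // ?mulr1n mulr1 mul1r taylor_coefM.
    case: (eqVneq c b) => [->|_] /=;
      rewrite ?mulr0 ?mul0r // ?mulr1n mulr1 mul1r taylor_coefM.
    by rewrite setUC.
  have : (\det N)%:M *m (\col_l gen (g l)) = 0.
    by rewrite -mul_adj_mx -mulmxA NU mulmx0.
  move/matrixP/(_ ord0 (ord0 : 'I_1)); rewrite mul_scalar_mx !mxE => /eqP.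
  by rewrite mulf_eq0 (negPf (sqfree_gen_neq0 _ _ _)) orbF => /eqP.
rewrite negb_forall => /existsP[k end_k].
have [a [b [l0 [c [gl0 b_im row_k lcm_k]]]]] : exists a b l0 (c : bool),
    [/\ g l0 = a, b \notin im,
        forall l, trow (e k).1 (e k).2 0 (g l) = (-1) ^+ c * (tcoef a b * (l ==
          l0)%:R)
      & u (e k).1 :|: u (e k).2 = u a :|: u b].
  have one_end a b l : g l = a -> b \notin im ->
      forall l', trow a b 0 (g l') = tcoef a b * (l' == l)%:R.
    move=> gl bim l'; have [->|nl] := eqVneq l' l.
      rewrite gl taylor_row_in ?mulr1 //.
      by apply: contraNneq bim => <-; rewrite -gl imset_f.
    rewrite taylor_row_out ?mulr0 // -?gl ?(inj_eq g_inj) //.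
    by apply: contraNneq bim => <-; rewrite imset_f.
  case: (e k) end_k => a b /=.
  have [/imsetP[l _ al]|aim] := boolP (a \in im).
    rewrite eq_sym eqb_id => bim; exists a, b, l, false; split=> // l'.
    by rewrite mul1r; apply: one_end.
  rewrite eq_sym eqbF_neg negbK => /imsetP[l _ bl].
  exists b, a, l, true; split=> // [l'|]; last exact: setUC.
  by rewrite mulN1r taylor_rowN mxE; congr (- _); apply: one_end.
have im_lift : [set g l | l : 'I_t.+1] = a |: [set g (lift l0 l) | l : 'I_t].
  apply/setP=> x; rewrite !inE; apply/imsetP/orP => [[l _ ->]|].
    case: (unliftP l0 l) => [l' ->|->]; last by left; rewrite gl0.
    by right; apply/imsetP; exists l'.
  case=> [/eqP->|/imsetP[l _ ->]]; last by exists (lift l0 l).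
  by exists l0; rewrite ?gl0.
have det_k : \det (edge_minor e g) = (-1) ^+ (c + (k + l0)) *
    (tcoef a b * \det (edge_minor (e \o lift k) (g \o lift l0))).
  rewrite (expand_det_row _ k) (bigD1 l0) //= big1 ?addr0 => [|l nl];
    last first.
    by rewrite mxE row_k (negPf nl) !mulr0 mul0r.
  rewrite mxE row_k eqxx mulr1 /cofactor edge_minor_minor.
  by rewrite [in RHS]exprD; apply: mulrACA.
have [|det0|[s [d [sC det_s exp_s]]]] := IH (e \o lift k) (g \o lift l0).
- by move=> x y /g_inj/lift_inj.
- by left; rewrite det_k det0 !mulr0.
right; exists ((a, b) :: s), (odd (c + (k + l0)) (+) d); split.
- rewrite /= in_setC b_im in_setC im_lift setU11 /=.
  move: sC; congr (spanning_forest _ _); apply/setP=> x; rewrite !inE negb_or.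
  have [->|_] //= := eqVneq x a.
  apply/negP=> /imsetP[l _]; rewrite /= -gl0 => /g_inj/eqP.
  by rewrite (negPf (neq_lift _ _)).
- rewrite det_k det_s signr_addb signr_odd /forest_exp big_cons mpolyXD.
  by rewrite (mulrCA (tcoef a b)) [LHS]mulrA.
rewrite /forest_exp big_cons -/(forest_exp s).
rewrite (bigD1_ord l0) //= (bigD1_ord k) //= -exp_s gl0 lcm_k -smonDU
  /edge_loss /=.
by rewrite -!addmA; congr (_ + _)%MM; rewrite !addmA (addmC (smon _)).
Qed.

(** Indexing by all ordered pairs repeats each relation up to sign and adds zero
    rows, which keeps the bookkeeping of minors free of conditions. *)
Definition taylor_mx : 'M[S]_(#|{: 'I_r * 'I_r}|, r) :=
  \matrix_k trow (enum_val k).1 (enum_val k).2.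

Lemma syz_taylor_mx v : syz u v = 0 <-> exists w, v = w *m taylor_mx.
Proof.
split=> [|[w ->]]; last first.
  rewrite mulmx_sum_row syz_sum big1 // => k _.
  by rewrite syzZ rowK syz_taylor mulr0.
apply: (@syz_taylor_span K n r u (fun v => exists w, v = w *m taylor_mx)).
- by exists 0; rewrite mul0mx.
- by move=> c _ _ [w1 ->] [w2 ->]; exists (c *: w1 + w2);
  rewrite mulmxDl scalemxAl.
- move=> a b; exists (delta_mx 0 (enum_rank (a, b))).
  by rewrite -rowE rowK enum_rankK.
Qed.

Lemma edge_minor_taylor t (e : 'I_t -> 'I_r * 'I_r) (g : 'I_t -> 'I_r) :
  \det (edge_minor e g) \in minors_ideal t taylor_mx.
Proof.
rewrite (_ : edge_minor e g = mxsub (fun k => enum_rank (e k)) g taylor_mx).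
  exact: minor_mem.
by apply/matrixP=> k l; rewrite [LHS]mxE [RHS]mxE [taylor_mx _ _]mxE enum_rankK.
Qed.

Variable I : idealOf S.
Hypothesis I_gen : I =i sqfree_ideal K u.

Lemma sqfree_gen_in a : gen a \in I.
Proof. by rewrite I_gen; apply: sqfree_gen_mem. Qed.

Lemma syz_onto f : f \in I -> exists v, f = syz u v.
Proof.
rewrite I_gen => /asboolP[k [b [g [Gg ->]]]].
have /boolp.choice[h gh] : forall i, exists a, g i = gen a.
  by move=> i; have [_ [a ->] ->] := Gg i; exists a.
exists (\sum_i b i *: delta_mx 0 (h i)); rewrite syz_sum; apply: eq_bigr => i _.
by rewrite syzZ syz_delta gh.
Qed.

Lemma syz_in v : syz u v \in I.
Proof. by apply: ideal_sum => a _; apply/idealMl/sqfree_gen_in. Qed.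

Lemma taylor_presents : presents (submod I) taylor_mx.
Proof.
pose g a : submod I := exist (fun f => f \in I) (gen a) (sqfree_gen_in a).
have val_g v : val (free_map g v) = syz u v.
  by rewrite /free_map raddf_sum; apply: eq_bigr.
exists (free_map g); split=> [x|v].
  have [v xv] := syz_onto (valP x); exists v; apply: val_inj.
  by rewrite /= val_g.
rewrite -syz_taylor_mx -val_g; split=> [->|v0]; first exact: raddf0.
by apply: val_inj; rewrite v0 raddf0.
Qed.

(** This lemma and the next: the Fitting ideal is generated by the monomials of
    the forests with [j] roots, because these are the nonzero Taylor minors. *)
Lemma forest_in_Fitt j C s : spanning_forest C s -> #|C| = j ->
  'X_[forest_exp s] \in Fitt j (submod I).
Proof.
move=> sC cardC; rewrite (Fitt_presents _ taylor_presents).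
have <- : size s = (r - j)%N by have := spanning_forest_size sC; lia.
by rewrite -(forest_minor sC); apply: edge_minor_taylor.
Qed.

Lemma Fitt_forest j (J : idealOf S) : (j <= r)%N ->
  (forall C s, spanning_forest C s -> #|C| = j -> 'X_[forest_exp s] \in J) ->
  {subset Fitt j (submod I) <= J}.
Proof.
move=> le_j CJ f; rewrite (Fitt_presents _ taylor_presents).
move: f; apply: minors_idealP => e g.
have [/injectiveP g_inj|/injectivePn[l [l' nl gl]]] := boolP (injectiveb g);
  last first.
  rewrite -det_tr (determinant_alternate nl); first exact: ideal0.
  by move=> k; rewrite !mxE gl.
rewrite (_ : mxsub e g taylor_mx = edge_minor (fun k => enum_val (e k)) g);
  last first.
  by apply/matrixP=> k l; rewrite [LHS]mxE [taylor_mx _ _]mxE [RHS]mxE.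
have [->|[s [b [sC -> _]]]] :=
  edge_minor_forest (fun k => enum_val (e k)) g_inj.
  exact: ideal0.
apply: idealMl; apply: CJ sC _.
have := cardsC [set g l | l : 'I_(r - j)].
by rewrite (card_imset _ g_inj) !card_ord => /(canRL (addKn _))->;
  rewrite subKn.
Qed.

End Forests.

(** * Vertex covers and forests *)

Lemma cardsU1_le (T : finType) (x : T) (A : {set T}) k :
  (#|A| <= k)%N -> (#|x |: A| <= k.+1)%N.
Proof. by rewrite cardsU1 -add1n => le_A; apply: leq_add => //;
  apply: leq_b1. Qed.

Lemma cardsU_le (T : finType) (A B : {set T}) a b :
  (#|A| <= a)%N -> (#|B| <= b)%N -> (#|A :|: B| <= a + b)%N.
Proof. by move=> leA leB; apply: leq_trans (leq_card_setU _ _) (leq_add leA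
  leB). Qed.

Section Covers.
Variables (n r : nat) (u : 'I_r -> {set 'I_n}).
Implicit Types (C : {set 'I_r}) (W : {set 'I_n}) (s : seq ('I_r * 'I_r)).
Local Notation loss := (edge_loss u).

(** Covers of the supports correspond to the primes generated by variables that
    contain the ideal, so lower bounds on covers express lower bounds on its grade.
    Below, a forest of a generator [u i] is efficient if its monomial divides the
    generator: then each variable is lost along at most one edge, and only if it
    belongs to [u i]. *)
Definition cover W := forall a, exists2 x, x \in W & x \in u a.

Lemma spanning_forest_uniq C s : spanning_forest C s -> uniq s.
Proof.
elim: s C => [|e s IH] C //= /and3P[_ eC sC]; rewrite (IH _ sC) andbT.
apply/negP=> /(spanning_forest_child sC).
by rewrite !inE eqxx.
Qed.

Lemma spanning_forest_edge C s e : spanning_forest C s -> e \in s -> e.1 != e.2.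
Proof.
elim: s C => [|e' s IH] C //= /and3P[e2 e1 sC].
rewrite inE => /predU1P[->|]; last exact: IH sC.
by apply: contraNneq e1 => ->.
Qed.

Lemma forest_expE s x : forest_exp u s x = count (fun e => x \in loss e) s.
Proof.
rewrite /forest_exp mnm_sumE -sum1_count [RHS]big_mkcond.
by apply: eq_bigr => e _; rewrite smonE; case: (_ \in _).
Qed.

Lemma forest_exp_le s (U : {set 'I_n}) : (forest_exp u s <= smon U)%MM ->
  (forall e, e \in s -> loss e \subset U) /\
  (forall x e e', e \in s -> e' \in s -> x \in loss e -> x \in loss e' ->
    e = e').
Proof.
move=> /mnm_lepP le_s; split=> [e es|x e e' es e's xe xe'].
  apply/subsetP=> x xe; have := le_s x; rewrite forest_expE smonE.
  case: (x \in U) => //; rewrite leqNgt -has_count => /negP[].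
  by apply/hasP; exists e.
have : (count (fun e => x \in loss e) s <= 1)%N.
  by rewrite -forest_expE; apply: leq_trans (le_s x) _; rewrite smonE leq_b1.
have : e \in filter (fun e => x \in loss e) s by rewrite mem_filter xe.
have : e' \in filter (fun e => x \in loss e) s by rewrite mem_filter xe'.
rewrite -size_filter; case: (filter _ s) => [|a [|]] //=.
by rewrite !inE => /eqP-> /eqP->.
Qed.

(** No variable outside [U := support of the forest monomial] is lost along an
    edge, so if each vertex had such a variable, choosing one for each root would
    give a cover with too few elements. *)
Lemma forest_support_gen C s : spanning_forest C s ->
  (forall W, cover W -> (#|C| < #|W|)%N) ->
  exists a, u a \subset [set x | forest_exp u s x != 0%N].
Proof.
move=> sC cov; set U := [set x | _].
have [//|noU] := EM (exists a, u a \subset U).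
have /boolp.choice[b bP] : forall a, exists x, x \in u a :\: U.
  move=> a; apply/set0Pn; apply: contra_notN noU.
  by rewrite setD_eq0 => ?; exists a.
have /cov : cover (b @: C).
  suff all_hit : forall v, exists2 x, x \in b @: C & x \in u v :\: U.
    by move=> v; have [x xW] := all_hit v; rewrite inE => /andP[_ xv]; exists x.
  apply: (spanning_forest_ind sC) => [c cC|e es [x xW xe]].
    by exists (b c); [apply: imset_f|apply: bP].
  exists x => //; move: xe; rewrite !inE => /andP[xU xe]; rewrite xU /=.
  apply: contraR xU => xe'; rewrite forest_expE -lt0n -has_count.
  by apply/hasP; exists e => //; rewrite inE xe'.
by rewrite ltnNge leq_imset_card.
Qed.

Hypothesis antichain : forall a b, u a \subset u b -> a = b.

Section OneForest.
Variables (i : 'I_r) (x : 'I_n) (C : {set 'I_r}) (s : seq ('I_r * 'I_r)).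
Hypotheses (xi : x \in u i) (sC : spanning_forest C s).
Hypothesis s_le : (forest_exp u s <= smon (u i))%MM.

Let lossS e : e \in s -> loss e \subset u i.
Proof. exact: (forest_exp_le s_le).1. Qed.

Let loss_once y e e' : e \in s -> e' \in s -> y \in loss e -> y \in loss e' ->
  e = e'.
Proof. exact: (forest_exp_le s_le).2. Qed.

Let b a := odflt x [pick y in u a :\: u i].

Let bP a : a != i -> b a \in u a :\: u i.
Proof.
move=> nai; rewrite /b; case: pickP => //= none.
suff : u a \subset u i by move/antichain/eqP; rewrite (negPf nai).
by rewrite -setD_eq0; apply/eqP/setP=> y; rewrite [RHS]inE; apply: none.
Qed.

(** A variable outside [u i] passes from each vertex to all its descendants; the
    variable [x] of [u i] does so except across one edge. *)
Lemma forest_cover W :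
  (forall c, c \in C -> x \in u c \/ exists2 y, y \in W & y \in u c :\: u i) ->
  (forall e, e \in s -> x \in loss e ->
     exists2 y, y \in W & y \in u e.1 :\: u i) ->
  x \in W -> cover W.
Proof.
move=> WC Ws xW.
suff all_hit : forall v, x \in u v \/ exists2 y, y \in W & y \in u v :\: u i.
  move=> v; case: (all_hit v) => [xv|[y yW]]; first by exists x.
  by rewrite inE => /andP[_ yv]; exists y.
apply: (spanning_forest_ind sC) => // e es [xe|[y yW]]; last first.
  rewrite inE => /andP[yi ye]; right; exists y => //; rewrite inE yi /=.
  apply: contraR yi => ye'; apply: (subsetP (lossS es)).
  by rewrite inE ye'.
have [?|xe'] := boolP (x \in u e.1); first by left.
by right; apply: Ws => //; rewrite inE xe'.
Qed.

(** Otherwise every root has a variable outside [u i], which reaches all the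
    descendants of this root, and [i] itself would get one. *)
Lemma root_mem : i \in C.
Proof.
apply: contraT => iC.
suff all_hit : forall v, exists y, y \in u v :\: u i.
  by have [y] := all_hit i; rewrite setDv inE.
apply: (spanning_forest_ind sC) => [c cC|e es [y]].
  by exists (b c); apply: bP; apply: contraNneq iC => <-.
rewrite inE => /andP[yi ye]; exists y; rewrite inE yi /=.
by apply: contraR yi => ye'; apply: (subsetP (lossS es)); rewrite inE ye'.
Qed.

(** Below the only edge where [x] is lost, a single variable outside [u i] does
    the work of [x]. *)
Lemma loss_repair : exists2 E : {set 'I_n}, (#|E| <= 1)%N &
  forall e, e \in s -> x \in loss e -> exists2 y, y \in E & y \in u e.1 :\: u i.
Proof.
have [[e [es xe]]|none] := EM (exists e, e \in s /\ x \in loss e); last first.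
  by exists set0; rewrite ?cards0 // => e es xe; case: none; exists e.
exists [set b e.1]; first by rewrite cards1.
move=> e' es' xe'; rewrite (loss_once es' es xe' xe).
exists (b e.1); first exact: set11.
apply: bP; apply: contraNneq (spanning_forest_child sC es) => ->.
exact: root_mem.
Qed.

(** One variable for each tree, and one more below the edge where [x] is lost. *)
Lemma small_cover : exists2 W, cover W & (#|W| <= #|C|.+1)%N.
Proof.
have [E E1 EP] := loss_repair.
exists (x |: (b @: (C :\ i) :|: E)).
  apply: forest_cover; last exact: setU11.
    move=> c cC; have [->|nci] := eqVneq c i; [by left|right].
    by exists (b c); rewrite ?bP // !inE imset_f ?orbT // !inE nci.
  move=> e es /(EP e es)[y yE ye]; exists y => //.
  by rewrite !inE yE !orbT.
apply: leq_trans (cardsU1_le _ (cardsU_le (leq_imset_card _ _) E1)) _.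
by rewrite addn1 (cardsD1 i C) root_mem.
Qed.

Hypothesis cov : forall W, cover W -> (#|C| < #|W|)%N.

(** A variable [x] shared by the roots [i] and [c] would serve both trees, at the
    price of one repair, and leave a cover with too few elements. *)
Lemma root_avoids c : c \in C -> c != i -> x \notin u c.
Proof.
move=> cC nci; apply/negP=> xc; have [E E1 EP] := loss_repair.
suff /cov : cover (x |: (b @: (C :\ i :\ c) :|: E)).
  rewrite ltnNge => /negP[].
  apply: leq_trans (cardsU1_le _ (cardsU_le (leq_imset_card _ _) E1)) _.
  by rewrite addn1 (cardsD1 i C) (cardsD1 c (C :\ i)) root_mem !inE nci cC.
apply: forest_cover; last exact: setU11.
  move=> d dC; have [->|ndi] := eqVneq d i; first by left.
  have [->|ndc] := eqVneq d c; [by left|right].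
  by exists (b d); rewrite ?bP // !inE imset_f ?orbT // !inE ndi ndc.
by move=> e es /(EP e es)[y yE ye]; exists y => //; rewrite !inE yE !orbT.
Qed.

(** A variable shared by two further roots would serve both of their trees. *)
Lemma roots_disjoint c c' z : c \in C -> c != i -> c' \in C -> c' != i ->
  c != c' -> z \in u c -> z \in u c' -> z \in u i.
Proof.
move=> cC nci c'C nc'i ncc' zc zc'; apply: contraT => zi;
  have [E E1 EP] := loss_repair.
suff /cov : cover (x |: (z |: (b @: (C :\ i :\ c :\ c') :|: E))).
  rewrite ltnNge => /negP[].
  apply: leq_trans (cardsU1_le _ (cardsU1_le _ (cardsU_le (leq_imset_card _ _)
    E1))) _.
  rewrite addn1 (cardsD1 i C) (cardsD1 c (C :\ i)) (cardsD1 c' (C :\ i :\ c)).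
  by rewrite root_mem !inE nci cC nc'i c'C eq_sym ncc'.
apply: forest_cover; last exact: setU11.
  move=> d dC; have [->|ndi] := eqVneq d i; [by left|right].
  have [->|ndc] := eqVneq d c; first by exists z;
    rewrite ?inE ?eqxx ?orbT // zi.
  have [->|ndc'] := eqVneq d c'; first by exists z;
    rewrite ?inE ?eqxx ?orbT // zi.
  by exists (b d); rewrite ?bP // !inE imset_f ?orbT // !inE ndi ndc ndc'.
by move=> e es /(EP e es)[y yE ye]; exists y => //; rewrite !inE yE !orbT.
Qed.

End OneForest.

(** An edge from another root [c] would lose a variable of [u c] that belongs to
    [u i], against [root_avoids]. *)
Lemma edge_parent_not_root i x C s e : x \in u i -> spanning_forest C s ->
  (forest_exp u s <= smon (u i))%MM -> (forall W, cover W -> (#|C| < #|W|)%N) ->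
  e \in s -> e.2 \in C -> e.2 = i.
Proof.
move=> xi sC s_le cov es e2C; apply/eqP; apply: contraT => ne2.
have e12 : u e.2 \subset u e.1.
  apply/subsetP=> y ye2; apply: contraT => ye1.
  have yi : y \in u i by apply: (subsetP ((forest_exp_le s_le).1 e es));
    rewrite inE ye1.
  by have := root_avoids yi sC s_le cov e2C ne2; rewrite ye2.
by have := spanning_forest_child sC es; rewrite -(antichain e12) e2C.
Qed.

(** The key step: were [u c] to meet some [u v], there would be an edge [a -> b]
    gaining a variable [z] of [u c]; a variable [x] lost along the same edge then
    completes [z] to a cover of the trees of [i] and [c]: the descendants of [b]
    contain [z], all other vertices of the tree of [i] contain [x]. *)
Lemma root_disjoint_all i C s c v : spanning_forest C s ->
  (forest_exp u s <= smon (u i))%MM -> (forall W, cover W -> (#|C| < #|W|)%N) ->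
  (exists x, x \in u i) -> c \in C -> c != i -> v != c -> [disjoint u c & u v].
Proof.
move=> sC s_le cov [x0 x0i] cC nci nvc; rewrite -setI_eq0; apply/set0Pn=> -[z].
rewrite inE => /andP[zc zv].
have zi : z \notin u i.
  by apply/negP=> zi; have := root_avoids zi sC s_le cov cC nci; rewrite zc.
have iC := root_mem x0 sC s_le.
suff no_z : forall w, w = c \/ z \notin u w.
  by case: (no_z v) => [eq_v|]; rewrite ?zv //; rewrite eq_v eqxx in nvc.
apply: (spanning_forest_ind sC) => [d dC|e es no_z2].
  have [->|ndc] := eqVneq d c; first by left.
  right; have [->//|ndi] := eqVneq d i; apply: contraT; rewrite negbK => zd.
  by rewrite (roots_disjoint x0i sC s_le cov cC nci dC ndi _ zc zd) // eq_sym
    in zi.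
right; apply/negP=> ze1.
have ne2 : e.2 <> c.
  move=> e2c; have := edge_parent_not_root x0i sC s_le cov es.
  by rewrite e2c => /(_ cC) ci; rewrite ci eqxx in nci.
have {no_z2 ne2} ze2 : z \notin u e.2 by case: no_z2.
have [x] : exists x, x \in loss e.
  apply/set0Pn; rewrite setD_eq0; apply/negP=> /antichain e21.
  by rewrite e21 ze1 in ze2.
move=> xe; have xi := subsetP ((forest_exp_le s_le).1 e es) x xe.
have out d : exists y, d != i -> y \in u d :\: u i.
  have [->|ndi] := eqVneq d i; first by exists x.
  have /set0Pn[y yd] : u d :\: u i != set0.
    by rewrite setD_eq0; apply: contra_neqN ndi; apply: antichain.
  by exists y.
have /boolp.choice[b bP] := out.
suff /cov : cover (x |: (z |: b @: (C :\ i :\ c))).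
  rewrite ltnNge => /negP[].
  apply: leq_trans (cardsU1_le _ (cardsU1_le _ (leq_imset_card _ _))) _.
  by rewrite (cardsD1 i C) (cardsD1 c (C :\ i)) iC !inE nci cC.
apply: (forest_cover sC s_le); last exact: setU11.
  move=> d dC; have [->|ndi] := eqVneq d i; [by left|right].
  have [->|ndc] := eqVneq d c; first by exists z;
    rewrite ?inE ?eqxx ?orbT // zi.
  by exists (b d); rewrite ?bP // !inE imset_f ?orbT // !inE ndi ndc.
move=> e' e's xe'; rewrite ((forest_exp_le s_le).2 x e' e e's es xe' xe).
by exists z; rewrite ?inE ?eqxx ?orbT // zi.
Qed.

(** Take a second root [c] of some efficient forest. As [u c] is disjoint from all
    the other supports, each edge of an efficient forest of [c] starts at [c] and
    loses the whole of [u c], which can happen only once. *)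
Lemma efficient_forests_few k : (2 <= k)%N -> (0 < r)%N ->
  (forall a, exists x, x \in u a) ->
  (forall W, cover W -> (k < #|W|)%N) ->
  (forall i, exists C s, [/\ spanning_forest C s, #|C| = k &
                            (forest_exp u s <= smon (u i))%MM]) ->
  (r <= k.+1)%N.
Proof.
move=> k2 r0 u0 cov forest; pose i := Ordinal r0.
have [C [s [sC Ck s_le]]] := forest i.
have covC : forall W, cover W -> (#|C| < #|W|)%N by rewrite Ck.
have [x xi] := u0 i; have iC := root_mem x sC s_le.
have [c] : exists c, c \in C :\ i.
  apply/set0Pn; rewrite -card_gt0 -ltnS.
  by have := cardsD1 i C; rewrite iC Ck add1n => <-.
rewrite !inE => /andP[nci cC].
have disj v : v != c -> [disjoint u c & u v].
  by apply: root_disjoint_all sC s_le covC _ cC nci; exists x.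
have [C' [s' [sC' C'k s'_le]]] := forest c.
have loss_c e : e \in s' -> loss e = u c.
  move=> es'; have lossS := (forest_exp_le s'_le).1 e es'.
  have [e2c|ne2] := eqVneq e.2 c; last first.
    have : u e.2 \subset u e.1.
      apply/subsetP=> y ye2; apply: contraT => ye1.
      have yc : y \in u c by apply: (subsetP lossS); rewrite inE ye1.
      by have := disjointFr (disj _ ne2) yc; rewrite ye2.
    move=> /antichain e21.
    by have := spanning_forest_edge sC' es'; rewrite e21 eqxx.
  rewrite /edge_loss e2c; apply/setDidPl; apply: disj.
  by rewrite -e2c; apply: spanning_forest_edge sC' es'.
have : (size s' <= 1)%N.
  have [y yc] := u0 c; have := spanning_forest_uniq sC'.
  case: s' loss_c s'_le {sC'} => [|e [|e' s']] //= loss_c s'_le.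
  have es : e \in [:: e, e' & s'] by rewrite mem_head.
  have e's : e' \in [:: e, e' & s'] by rewrite !inE eqxx orbT.
  rewrite ((forest_exp_le s'_le).2 y e e' es e's); first by rewrite mem_head.
    by rewrite loss_c.
  by rewrite loss_c.
have := spanning_forest_size sC'; rewrite C'k => size_s' s1.
by apply: leq_trans (leq_add s1 (leqnn k)); rewrite size_s'.
Qed.

Lemma cover_size_le k : (forall a, exists x, x \in u a) ->
  (forall W, cover W -> (k < #|W|)%N) -> (k < r)%N.
Proof.
move=> /boolp.choice[b bP] cov; rewrite -[r]card_ord -cardsT.
apply: leq_trans (cov (b @: setT) _) (leq_imset_card _ _) => a.
by exists (b a); rewrite ?imset_f.
Qed.

(** Two supports sharing a variable would save one element in a cover made of one
    variable for each support. *)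
Lemma disjoint_of_few k : (r <= k.+1)%N ->
  (forall a, exists x, x \in u a) ->
  (forall W, cover W -> (k < #|W|)%N) ->
  forall a c, a != c -> [disjoint u a & u c].
Proof.
move=> rk /boolp.choice[b bP] cov a c nac; rewrite -setI_eq0;
  apply/set0Pn=> -[z].
rewrite inE => /andP[za zc].
have /cov : cover (z |: b @: (setT :\ a :\ c)).
  move=> d; have [->|nda] := eqVneq d a; first by exists z; rewrite ?setU11.
  have [->|ndc] := eqVneq d c; first by exists z; rewrite ?setU11.
  by exists (b d); rewrite // !inE imset_f ?orbT // !inE nda ndc.
rewrite ltnNge => /negP[].
apply: leq_trans (cardsU1_le _ (leq_imset_card _ _)) _.
move: rk; rewrite -[in X in X -> _](card_ord r) -cardsT.
by rewrite (cardsD1 a) (cardsD1 c (_ :\ a)) !inE eq_sym nac.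
Qed.

End Covers.

(** * Noetherianity of polynomial rings *)

Section Dickson.

Lemma nat_seq_min (f : nat -> nat) N :
  exists2 k, (N <= k)%N & forall l, (N <= l)%N -> (f k <= f l)%N.
Proof.
suff main v : (exists2 k, (N <= k)%N & (f k <= v)%N) ->
    exists2 k, (N <= k)%N & forall l, (N <= l)%N -> (f k <= f l)%N.
  by apply: (main (f N)); exists N.
elim: v => [|v IH] [k Nk fk].
  by exists k => // l _; apply: leq_trans fk _.
have [less|none] := EM (exists2 k, (N <= k)%N & (f k <= v)%N); first exact: IH.
exists k => // l Nl; apply: leq_trans fk _; rewrite ltnNge.
by apply/negP=> fl; apply: none; exists l.
Qed.

Lemma nat_subseq_nondecreasing (f : nat -> nat) : exists phi : nat -> nat,
  forall k, (phi k < phi k.+1)%N /\ (f (phi k) <= f (phi k.+1))%N.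
Proof.
have /boolp.choice[g gP] : forall N, exists k, (N <= k)%N /\
    forall l, (N <= l)%N -> (f k <= f l)%N.
  by move=> N; have [k Nk kP] := nat_seq_min f N; exists k.
pose phi := fix phi k := if k is k'.+1 then g (phi k').+1 else g 0%N.
exists phi => k; split; first exact: (gP _).1.
have lt_phi : (phi k <= phi k.+1)%N by apply: ltnW; apply: (gP _).1.
case: k lt_phi => [|k] lt_phi; first exact: (gP 0%N).2.
by apply: (gP (phi k).+1).2; apply: leq_trans lt_phi; apply: (gP _).1.
Qed.

Lemma homo_step_lt (phi : nat -> nat) : (forall k, (phi k < phi k.+1)%N) ->
  {homo phi : k l / (k < l)%N}.
Proof. by move=> step; apply: homo_ltn => //; apply: ltn_trans. Qed.

Lemma subseq_nondecreasing (I : eqType) (l : seq I) (f : nat -> I -> nat) :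
  exists phi : nat -> nat, forall k, (phi k < phi k.+1)%N /\
    (forall i, i \in l -> (f (phi k) i <= f (phi k.+1) i)%N).
Proof.
elim: l => [|i l [phi phiP]]; first by exists id.
have [psi psiP] := nat_subseq_nondecreasing (fun k => f (phi k) i).
have phi_lt := homo_step_lt (fun k => (phiP k).1).
exists (phi \o psi) => k; split; first exact/phi_lt/(psiP k).1.
move=> i'; rewrite inE => /predU1P[->|i'l]; first exact: (psiP k).2.
apply: (@homo_leq _ (fun k => f (phi k) i') (fun a b => a <= b)%N) => //.
- exact: leq_trans.
- by move=> k'; apply: (phiP k').2.
exact/ltnW/(psiP k).1.
Qed.

(** Otherwise an infinite sequence without any divisibility from an earlier to a
    later term could be chosen, but it has a nondecreasing subsequence. *)
Lemma dickson n (P : 'X_{1..n} -> Prop) : exists2 s : seq 'X_{1..n},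
  (forall m, m \in s -> P m) &
  (forall m, P m -> exists2 m0, m0 \in s & (m0 <= m)%MM).
Proof.
apply: contrapT => nobasis.
have next (s : seq 'X_{1..n}) : exists m, (forall m0, m0 \in s -> P m0) ->
    P m /\ (forall m0, m0 \in s -> ~~ (m0 <= m)%MM).
  have [sP|nsP] := EM (forall m0, m0 \in s -> P m0); last by exists 0%MM.
  have [[m mP]|none] := EM (exists m, P m /\ (forall m0, m0 \in s ->
    ~~ (m0 <= m)%MM)).
    by exists m.
  case: nobasis; exists s => // m Pm.
  have [//|none'] := EM (exists2 m0, m0 \in s & (m0 <= m)%MM).
  case: none; exists m; split=> // m0 m0s; apply/negP=> le_m.
  by apply: none'; exists m0.
have /boolp.choice[h hP] := next.
pose s := fix s k := if k is k'.+1 then h (s k') :: s k' else [::].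
have sP k : forall m0, m0 \in s k -> P m0.
  elim: k => [//|k IH] m0; rewrite inE => /predU1P[->|]; last exact: IH.
  by case: (hP _ IH).
have s_mem k l : (k < l)%N -> h (s k) \in s l.
  elim: l => [//|l IH]; rewrite ltnS leq_eqVlt => /predU1P[->|/IH kl].
    exact: mem_head.
  by rewrite inE kl orbT.
have [phi phiP] := subseq_nondecreasing (enum 'I_n) (fun k i => h (s k) i).
have [lt01 le01] := phiP 0%N.
have /negP[] := (hP _ (sP (phi 1%N))).2 _ (s_mem _ _ lt01).
by apply/mnm_lepP => i; apply: le01; rewrite mem_enum.
Qed.

End Dickson.

Section Noetherian.
Import Order.Theory.
Variables (K : fieldType) (n : nat).
Local Notation S := {mpoly K[n]}.
Implicit Types (J : idealOf S) (f g : S).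

(** Hilbert's basis theorem: by Dickson's lemma finitely many leading monomials
    divide all the others, and division by the corresponding elements ends. *)
Lemma ideal_finitely_generated J : exists2 s : seq S,
  {subset s <= J} & {subset J <= ideal_seq s}.
Proof.
have [l lP l_div] := dickson (fun m =>
  exists f, [/\ f \in J, f != 0 & mlead f = m]).
have /boolp.choice[F FP] : forall m, exists f : S,
    m \in l -> [/\ f \in J, f != 0 & mlead f = m].
  by move=> m; case: (boolP (m \in l)) => [/lP[f fP]|_]; [exists f|exists 0].
exists [seq F m | m <- l] => [_ /mapP[m /FP[fJ _ _] ->] //|f].
elim/mleadrect: f => f IH fJ.
have [->|f0] := eqVneq f 0; first exact: ideal0.
have [m ml le_m] : exists2 m, m \in l & (m <= mlead f)%MM by apply: l_div;
  exists f.
have [gJ g0 g_lead] := FP m ml; set g := F m in gJ g0 g_lead.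
pose h : S := (mleadc f / mleadc g) *: 'X_[mlead f - m].
have fg : mleadc f / mleadc g != 0 by rewrite mulf_neq0 ?invr_eq0 ?mleadc_eq0.
have h_lead : mlead h = (mlead f - m)%MM.
  by rewrite /h mleadZ_proper mleadXm // mcoeffX eqxx mulr1.
have h0 : h != 0 by rewrite -mleadc_eq0 h_lead /h mcoeffZ mcoeffX eqxx mulr1.
have hg_lead : mlead (h * g) = mlead f by rewrite mleadM // h_lead g_lead submK.
have hg_coef : (h * g)@_(mlead f) = mleadc f.
  rewrite -hg_lead mleadM // mleadcM h_lead /h mcoeffZ mcoeffX eqxx mulr1.
  by rewrite divfK ?mleadc_eq0 // g_lead submK.
have hg_in : h * g \in ideal_seq [seq F m | m <- l].
  by apply/idealMl/mem_ideal_seq/map_f.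
rewrite -[f](subrK (h * g)); apply: idealD => //.
have [->|q0] := eqVneq (f - h * g) 0; first exact: ideal0.
apply: IH; last by apply: idealB => //; apply: idealMl.
rewrite lt_neqAle; apply/andP; split.
  apply: contraNneq q0 => q_lead; rewrite -mleadc_eq0 q_lead mcoeffB hg_coef.
  by rewrite subrr.
apply: le_trans (mleadB_le _ _) _.
by rewrite hg_lead joinxx.
Qed.

Lemma ideal_gen_closed (G : S -> Prop) : G 0 ->
  (forall a x y, G x -> G y -> G (a * x + y)) ->
  forall x, x \in ideal_gen G -> G x.
Proof.
move=> G0 Glin x /asboolP[k [a [g [Gg ->]]]].
by elim/big_rec: _ => // i y _ Gy; apply: Glin.
Qed.

Lemma ideal_gen_finite (G : S -> Prop) : exists2 s : seq S,
  (forall x, x \in s -> G x) & {subset ideal_gen G <= ideal_seq s}.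
Proof.
have [t tG Gt] := ideal_finitely_generated (ideal_gen G).
suff [s sG ts] : exists2 s : seq S, (forall x, x \in s ->
  G x) & {subset t <= ideal_seq s}.
  by exists s => // x /Gt; apply: ideal_seq_sub.
elim: t tG {Gt} => [|y t IH] tG; first by exists [::].
have [s sG ts] : exists2 s : seq S, (forall x, x \in s ->
  G x) & {subset t <= ideal_seq s}.
  by apply: IH => x xt; apply: tG; rewrite inE xt orbT.
have /asboolP[k [a [g [Gg y_eq]]]] := tG y (mem_head _ _).
exists (codom g ++ s) => [x|x].
  by rewrite mem_cat => /orP[/codomP[i ->]|/sG].
rewrite inE => /predU1P[->|/ts].
  rewrite y_eq; apply: ideal_sum => i _; apply/idealMl/mem_ideal_seq.
  by rewrite mem_cat codom_f.
apply: ideal_seq_sub => z zs; apply: mem_ideal_seq.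
by rewrite mem_cat zs orbT.
Qed.

(** The ascending chain condition, as the existence of maximal members in a
    nonempty family of ideals. *)
Lemma ideal_family_max (T : Type) (P : T -> Prop) (A : T -> S -> Prop) t0 :
  (forall t, P t -> A t 0 /\ forall a x y, A t x -> A t y -> A t (a * x + y)) ->
  P t0 -> exists t, [/\ P t, forall x, A t0 x -> A t x &
    forall t', P t' -> (forall x, A t x -> A t' x) ->
      forall x, A t' x -> A t x].
Proof.
move=> A_ideal Pt0; apply: contrapT => nomax.
have next t : exists t', P t /\ (forall x, A t0 x -> A t x) ->
    [/\ P t', forall x, A t x -> A t' x & exists2 x, A t' x & ~ A t x].
  have [[Pt t0t]|nPt] := EM (P t /\ (forall x, A t0 x -> A t x));
    last by exists t.
  apply: contrapT => none; apply: nomax; exists t; split=> // t' Pt' tt' x t'x.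
  apply: contrapT => ntx; apply: none; exists t' => _; split=> //.
  by exists x.
have /boolp.choice[h hP] := next.
pose c := fix c k := if k is k'.+1 then h (c k') else t0.
have cP k : P (c k) /\ (forall x, A t0 x -> A (c k) x).
  elim: k => [//|k IH]; have [Pc sub _] := hP _ IH.
  by split=> // x /IH.2; apply: sub.
have c_homo k l x : (k <= l)%N -> A (c k) x -> A (c l) x.
  move=> /subnK<-; elim: (l - k)%N => [//|d IH] Ax.
  by have [_ sub _] := hP _ (cP (d + k)%N); apply/sub/IH.
pose U x := exists k, A (c k) x.
have U_closed : forall x, x \in ideal_gen U -> U x.
  apply: ideal_gen_closed => [|a x y [k Ax] [l Ay]].
    by exists 0%N; case: (A_ideal _ (cP 0%N).1).
  exists (maxn k l); apply: (A_ideal _ (cP _).1).2.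
    exact: c_homo (leq_maxl _ _) Ax.
  exact: c_homo (leq_maxr _ _) Ay.
have [s sU Us] := ideal_gen_finite U.
have [N sN] : exists N, forall x, x \in s -> A (c N) x.
  elim: s sU {Us} => [|x s IH] sU; first by exists 0%N.
  have [N sN] : exists N, forall x, x \in s -> A (c N) x.
    by apply: IH => y ys; apply: sU; rewrite inE ys orbT.
  have [k Ax] := sU x (mem_head _ _).
  exists (maxn k N) => y; rewrite inE => /predU1P[->|/sN Ay].
    exact: c_homo (leq_maxl _ _) Ax.
  exact: c_homo (leq_maxr _ _) Ay.
have [_ _ [x xN1 xN]] := hP _ (cP N); apply: xN.
have : x \in ideal_seq s by apply/Us/mem_ideal_gen; exists N.+1.
have [A0 Alin] := A_ideal _ (cP N).1.
case/asboolP=> k [a [g [gs ->]]]; elim/big_rec: _ => // i y _ Ay.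
by apply: Alin => //; apply: sN.
Qed.

(** * Zero divisors modulo an ideal *)

Section ZeroDivisors.
Variable J : idealOf S.

Definition annihilates (z y : S) : Prop := z * y \in J.

Definition max_annihilated (z : S) : Prop := z \notin J /\
  forall z', z' \notin J -> (forall y, annihilates z y -> annihilates z' y) ->
    forall y, annihilates z' y -> annihilates z y.

(** Passing from [z] to [z * b] enlarges the annihilator, unless [z * b] is in
    [J]. *)
Lemma annihilates_prime z a b : max_annihilated z ->
  annihilates z (a * b) -> annihilates z a \/ annihilates z b.
Proof.
move=> [zJ z_max] zab; have [zb|zb] := boolP (z * b \in J); [by right|left].
apply: (z_max (z * b) zb); last by rewrite /annihilates -mulrA (mulrC b).
by move=> y zy; rewrite /annihilates mulrAC; apply: idealMr.
Qed.

Lemma annihilates_max z : z \notin J ->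
  exists2 z', max_annihilated z' & forall y, annihilates z y ->
    annihilates z' y.
Proof.
move=> zJ; have [|z' [z'J zz' z'_max]] :=
    @ideal_family_max S (fun z => z \notin J) annihilates z _ zJ.
  move=> t _; split=> [|a x y tx ty];
    first by rewrite /annihilates mulr0 ideal0.
  by rewrite /annihilates mulrDr mulrCA; apply: idealD => //; apply: idealMl.
by exists z'.
Qed.

Lemma annihilates_prod z (zs : seq S) : max_annihilated z ->
  (forall z', z' \in zs -> exists2 t, annihilates z' t & ~ annihilates z t) ->
  exists2 t, ~ annihilates z t & forall z', z' \in zs -> annihilates z' t.
Proof.
move=> z_max; elim: zs => [|z' zs IH] zsP.
  by exists 1 => //; rewrite /annihilates mulr1; apply/negP; case: z_max.
have [t zt zst] : exists2 t, ~ annihilates z t & forall z', z' \in zs ->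
  annihilates z' t.
  by apply: IH => y ys; apply: zsP; rewrite inE ys orbT.
have [t' z't' zt'] := zsP z' (mem_head _ _).
exists (t * t') => [/(annihilates_prime z_max)[]//|y].
rewrite inE /annihilates => /predU1P[->|/zst yt].
  by rewrite mulrCA; apply: idealMl.
by rewrite mulrA; apply: idealMr.
Qed.

(** The maximal annihilators of elements modulo [J] are prime, finitely many of
    them cover all zero divisors, and prime avoidance applies to these. *)
Lemma regular_element (I : idealOf S) :
  (forall z, z \notin J -> exists2 y, y \in I & z * y \notin J) ->
  exists2 y, y \in I & forall z, y * z \in J -> z \in J.
Proof.
move=> I_free; have [zs zs_max gen_zs] := ideal_gen_finite max_annihilated.
have [y yI y_avoid] : exists2 y, y \in I & forall z, z \in zs ->
  ~ annihilates z y.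
  elim: zs zs_max {gen_zs} => [|z zs IH] zs_max.
    by exists 0 => //; apply: ideal0.
  have [y yI y_avoid] : exists2 y, y \in I & forall z, z \in zs ->
    ~ annihilates z y.
    by apply: IH => z' z's; apply: zs_max; rewrite inE z's orbT.
  have z_max := zs_max z (mem_head _ _).
  have [zy|zy] := EM (annihilates z y); last first.
    by exists y => // z'; rewrite inE => /predU1P[->//|/y_avoid].
  have [t zt zst] : exists2 t, ~ annihilates z t & forall z', z' \in zs ->
    annihilates z' t.
    apply: annihilates_prod => // z' z's; apply: contrapT => none.
    have z'_max : max_annihilated z' by apply: zs_max; rewrite inE z's orbT.
    apply: (y_avoid z' z's); apply: (z'_max.2 z z_max.1) => // y' z'y'.
    by apply: contrapT => nzy'; apply: none; exists y'.
  have [w wI zw] := I_free z z_max.1.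
  exists (y + w * t); first by apply: idealD => //; apply: idealMr.
  move=> z'; rewrite inE /annihilates mulrDr => /predU1P[->|z's] bad.
    have : annihilates z (w * t).
      by rewrite /annihilates -[_ * _](addKr (z * y)); apply: idealD => //;
        apply: idealN.
    by case/(annihilates_prime z_max) => //; apply/negP.
  apply: (y_avoid z' z's); rewrite /annihilates -[_ * _](addrK (z' * (w * t))).
  by apply: idealB => //; rewrite mulrCA; apply: idealMl; apply: zst.
exists y => // z; rewrite mulrC => zy; apply: contraT => zJ.
have [z' z'_max zz'] := annihilates_max zJ.
have [[z1 z1s z1z']|none] := EM (exists2 z1, z1 \in zs &
    forall t, annihilates z1 t -> annihilates z' t).
  case: (y_avoid z1 z1s); apply: (zs_max z1 z1s).2 z'_max.1 z1z' _ _.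
  exact: zz'.
have [t z't zst] : exists2 t, ~ annihilates z' t & forall z1, z1 \in zs ->
  annihilates z1 t.
  apply: annihilates_prod => // z1 z1s; apply: contrapT => none1.
  apply: none; exists z1 => // t z1t; apply: contrapT => nz't.
  by apply: none1; exists t.
case: z't; suff sub : {subset ideal_seq zs <= ideal_gen (fun x =>
  annihilates x t)}.
  apply: (@ideal_gen_closed (fun x => annihilates x t)) => [|a x x' xt x't|].
  - by rewrite /annihilates mul0r ideal0.
  - by rewrite /annihilates mulrDl -mulrA; apply: idealD => //; apply: idealMl.
  - exact/sub/gen_zs/mem_ideal_gen.
by apply: ideal_seq_sub => x /zst;
  apply: (@mem_ideal_gen _ (fun x => annihilates x t)).
Qed.

End ZeroDivisors.

(** * Maximal regular sequences of length two *)

(** If every element of [I] is a zero divisor modulo a regular pair [f1, f2],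
    then some [z] outside [(f1, f2)] multiplies [I] into it, which is a nonzero
    element of Hom(S/I, S/(f1, f2)) = Ext^2(S/I, S). A regular sequence
    [a1, a2, a3] in [I] forces this module to vanish: the Koszul relations between
    [f1, f2] give [c12, c13, c23] with [a3 c12 = a2 c13 - a1 c23], and [c12] being
    in [(a1, a2)] lets [z] be corrected to an element of [(f1, f2)]. *)
Lemma grade2_max (I : idealOf S) (g : nat) :
  1 \notin I -> has_grade I 2 -> has_grade I g -> (g <= 2)%N.
Proof.
move=> I1 [s [s_reg sI s_max] size_s] [t [t_reg tI _] <-]; rewrite leqNgt.
apply/negP=> lt_t.
case: s size_s s_reg sI s_max => [|f1 [|f2 []]] //= _ s_reg sI s_max.
case: t lt_t t_reg tI => [|a1 [|a2 [|a3 t]]] //= _ t_reg tI.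
have f1I : f1 \in I by apply: sI; rewrite inE eqxx.
have f2I : f2 \in I by apply: sI; rewrite !inE eqxx orbT.
have a1I : a1 \in I by apply: tI; rewrite inE eqxx.
have a2I : a2 \in I by apply: tI; rewrite !inE eqxx orbT.
have a3I : a3 \in I by apply: tI; rewrite !inE eqxx !orbT.
have [regf f_1] := (regular_seqP _).1 s_reg.
have [rega _] := (regular_seqP _).1 t_reg.
have nz1 (b : S) : (forall x, b * x \in ideal_seq [::] ->
  x \in ideal_seq ([::] : seq S)) ->
    b != 0.
  move=> reg; apply/eqP=> b0; have := reg 1;
    rewrite b0 mul0r ideal0 => /(_ isT).
  by move/ideal_seq_nil/eqP; rewrite oner_eq0.
have f1_0 : f1 != 0 by apply: nz1; exact: (regf 0%N).
have a1_0 : a1 != 0 by apply: nz1; exact: (rega 0%N).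
have reg_f2 x y : f2 * x = y * f1 -> exists c, x = c * f1.
  move=> xy; apply: ideal_seq1P; apply: (regf 1%N) => //=.
  by rewrite xy; apply/idealMl/mem_ideal_seq/mem_head.
have reg_a2 x y : a2 * x = y * a1 -> exists c, x = c * a1.
  move=> xy; apply: ideal_seq1P; apply: (rega 1%N) => //=.
  by rewrite xy; apply/idealMl/mem_ideal_seq/mem_head.
have [z zJ zI] : exists2 z, z \notin ideal_seq [:: f1; f2] &
    forall y, y \in I -> z * y \in ideal_seq [:: f1; f2].
  apply: contrapT => none.
  have [|y yI y_reg] := @regular_element (ideal_seq [:: f1; f2]) I.
    move=> z zJ; apply: contrapT => none'; apply: none; exists z => // y yI.
    by apply: contraT => nzy; case: none'; exists y.
  apply: (s_max y yI); apply: (regular_seq_rcons s_reg y_reg).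
  apply: contra I1; apply: ideal_seq_sub => x.
  by rewrite /= !inE => /or3P[] /eqP->.
have /ideal_seq2P[al1 [be1 z1]] := zI _ a1I.
have /ideal_seq2P[al2 [be2 z2]] := zI _ a2I.
have /ideal_seq2P[al3 [be3 z3]] := zI _ a3I.
have koszul ai ali bei ak alk bek : z * ai = ali * f1 + bei * f2 ->
    z * ak = alk * f1 + bek * f2 ->
    exists c, ak * bei - ai * bek = c * f1 /\ ak * ali - ai * alk = - (c * f2).
  move=> zi zk; have rel : f2 * (ak * bei - ai * bek) = - (ak * ali - ai * alk)
    * f1.
    apply/eqP; rewrite -subr_eq0; apply/eqP.
    transitivity (ak * (ali * f1 + bei * f2) - ai * (alk * f1 + bek * f2));
      first by ring.
    by rewrite -zi -zk; ring.
  have [c eq_c] := reg_f2 _ _ rel; exists c; split=> //.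
  apply: (mulIf f1_0); rewrite mulNr -mulrA (mulrC f2) mulrA -eq_c.
  by rewrite (mulrC _ f2) rel; ring.
have [c12 [b12 a12]] := koszul _ _ _ _ _ _ z1 z2.
have [c13 [b13 _]] := koszul _ _ _ _ _ _ z1 z3.
have [c23 [b23 _]] := koszul _ _ _ _ _ _ z2 z3.
have c_rel : a3 * c12 = a2 * c13 - a1 * c23.
  apply: (mulIf f1_0).
  have -> : a3 * c12 * f1 = a3 * (a2 * be1 - a1 * be2) by rewrite b12; ring.
  have -> : (a2 * c13 - a1 * c23) * f1 =
            a2 * (a3 * be1 - a1 * be3) - a1 * (a3 * be2 - a2 * be3).
    by rewrite b13 b23; ring.
  by ring.
have /ideal_seq2P[p [q c12_eq]] : c12 \in ideal_seq [:: a1; a2].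
  apply: (rega 2%N) => //=; rewrite c_rel.
  by apply: idealB; apply: idealMr; apply: mem_ideal_seq;
    rewrite !inE eqxx ?orbT.
have [t1 t1_eq] : exists c, be1 - q * f1 = c * a1.
  apply: (reg_a2 _ (be2 + p * f1)); have := b12; rewrite c12_eq => b12'.
  by rewrite mulrBr; apply/eqP;
    rewrite subr_eq -(subrK (a1 * be2) (a2 * be1)) b12';
    apply/eqP; ring.
have [s1 s1_eq] : exists c, al1 + q * f2 = c * a1.
  apply: (reg_a2 _ (al2 - p * f2)); have := a12; rewrite c12_eq => a12'.
  by rewrite mulrDr -(subrK (a1 * al2) (a2 * al1)) a12'; ring.
apply/negP: zJ; rewrite negbK.
have -> : z = s1 * f1 + t1 * f2.
  apply: (mulIf a1_0); rewrite z1 -(subrK (q * f1) be1) t1_eq -(addrK (q * f2)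
    al1) s1_eq.
  by ring.
by apply: idealD; apply/idealMl/mem_ideal_seq; rewrite !inE eqxx ?orbT.
Qed.

End Noetherian.

(** * Projective dimension *)

Section Lifting.
Variable R : comNzRingType.

Section Image.
Variables (V W : lmodType R) (f : {linear V -> W}).

Definition lin_image : {pred W} := fun x => `[< exists y, f y = x >].

Lemma lin_image_submod : subsemimod_closed lin_image.
Proof.
split=> [|a _ /asboolP[y <-]]; last by apply/asboolP; exists (a *: y);
  rewrite linearZ.
split=> [|_ _ /asboolP[y <-] /asboolP[z <-]]; first by apply/asboolP; exists 0;
  rewrite linear0.
by apply/asboolP; exists (y + z); rewrite linearD.
Qed.

HB.instance Definition _ := GRing.isSubmodClosed.Build R W lin_image
  lin_image_submod.

End Image.

Section Corestriction.
Variables (V W : lmodType R) (N : submodClosed W) (f : {linear V -> W}).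
Hypothesis fN : forall x, f x \in N.

Definition corestrict (x : V) : submod N :=
  exist (fun y => y \in N) (f x) (fN x).

Lemma corestrict_linear : linear corestrict.
Proof. by move=> a x y; apply: val_inj; rewrite /= linearP. Qed.

HB.instance Definition _ := GRing.isLinear.Build R V (submod N) *:%R corestrict
  corestrict_linear.

End Corestriction.

(** Corestriction to the image of [phi] allows lifting along a map that need not be
    surjective. *)
Lemma projective_lift (P F W : lmodType R) (phi : {linear F -> W})
    (g : {linear P -> W}) : projective P -> (forall x, exists y, phi y = g x) ->
  exists h : {linear P -> F}, forall x, phi (h x) = g x.
Proof.
move=> P_proj g_in.
have phiN x : phi x \in lin_image phi by apply/asboolP; exists x.
have gN x : g x \in lin_image phi by apply/asboolP; apply: g_in.
have [|h hP] := P_proj _ _ (corestrict phiN) (corestrict gN).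
  by move=> [y yN]; have /asboolP[x xy] := yN; exists x; apply: val_inj.
by exists h => x; have := congr1 val (hP x).
Qed.

Lemma free_map_delta (V : lmodType R) m (w : 'I_m -> V) i :
  free_map w (delta_mx 0 i) = w i.
Proof.
rewrite /free_map (bigD1 i) //= mxE !eqxx scale1r big1 ?addr0 // => j ji.
by rewrite mxE (negPf ji) andbF scale0r.
Qed.

Lemma linear_free_map (V W : lmodType R) (f : {linear V -> W}) m (w : 'I_m ->
  V) v :
  f (free_map w v) = free_map (f \o w) v.
Proof. by rewrite /free_map linear_sum; apply: eq_bigr => i _;
  rewrite linearZ. Qed.

Lemma free_map_rows m r (w : 'I_m -> 'rV[R]_r) v :
  free_map w v = v *m \matrix_i w i.
Proof. by rewrite mulmx_sum_row; apply: eq_bigr => i _; rewrite rowK. Qed.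

Lemma free_projective m : projective ('rV[R]_m : lmodType R).
Proof.
move=> M N f g f_surj.
have /boolp.choice[w wP] := fun i => f_surj (g (delta_mx 0 i)).
exists (free_map w) => v; rewrite linear_free_map [in RHS](row_sum_delta v)
  linear_sum.
by apply: eq_bigr => i _; rewrite linearZ /= wP.
Qed.

Variable I : idealOf R.

Definition pi_fun (x : R^o) : quotmod I := quotmod_pi I x.

Lemma pi_linear : linear pi_fun.
Proof. by move=> a x y; rewrite /pi_fun quotmod_piD -quotmod_piZ. Qed.

HB.instance Definition _ := GRing.isLinear.Build R R^o (quotmod I) *:%R pi_fun
  pi_linear.

Lemma pi_fun_eq0 x : pi_fun x = 0 <-> x \in I.
Proof. by rewrite -pi_eq0; split=> /eqP. Qed.

End Lifting.

Section IdealPresentation.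
Variables (R : comNzRingType) (I : idealOf R) (m r : nat).
Variables (gen : 'I_r -> R^o) (D : 'M[R]_(m, r)).
Hypothesis gen_in : forall v, free_map gen v \in I.
Hypothesis gen_onto : forall x, x \in I -> exists v, x = free_map gen v.
Hypothesis rel : forall v, free_map gen v = 0 <-> exists w, v = w *m D.

(** A short projective resolution splits off the module of relations as soon as
    it is compared with the given presentation: [free_map q], [free_map y] and
    [b0], [b1], [b2] are chain maps in the two directions, [h] and [k] a homotopy
    from their composite to the identity. The resulting [Q] is an idempotent with
    the same left kernel as [D], so that its image is a copy of the module of
    relations. *)
Lemma pdim_le2_split l : pdim_le (quotmod I) l -> (l <= 2)%N ->
  exists Q : 'M[R]_m, [/\ Q *m D = D, forall v : 'rV_m, v *m D = 0 -> v *m Q = 0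
    & (l <= 1)%N -> exists H, Q = D *m H].
Proof.
move=> [P [d [eps [[P_proj eps_surj eps_ker d_ker] P0]]]] l2.
have [p0 eps_p0] := eps_surj (pi_fun I 1).
have /boolp.choice[q qP] : forall a, exists y, d 0%N y = gen a *: p0.
  move=> a; apply/eps_ker; rewrite linearZ /= eps_p0 -linearZ /=.
  apply/pi_fun_eq0; rewrite [_ *: _]mulr1 -[gen a]free_map_delta.
  exact: gen_in.
have d0_q v : d 0%N (free_map q v) = free_map gen v *: p0.
  rewrite linear_free_map /free_map scaler_suml; apply: eq_bigr => a _ /=.
  by rewrite qP scalerA.
have /boolp.choice[y yP] : forall k, exists y, d 1%N y = free_map q (row k D).
  move=> k; apply/d_ker; rewrite d0_q.
  suff -> : free_map gen (row k D) = 0 by rewrite scale0r.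
  by apply/rel; exists (delta_mx 0 k); rewrite -rowE.
have d1_y v : d 1%N (free_map y v) = free_map q (v *m D).
  rewrite linear_free_map mulmx_sum_row linear_sum; apply: eq_bigr => k _ /=.
  by rewrite yP linearZ.
have y_inj v : v *m D = 0 -> free_map y v = 0.
  move=> vD; have /d_ker[z <-] : d 1%N (free_map y v) = 0 by rewrite d1_y vD
    linear0.
  by rewrite (P0 3 _ z) ?linear0.
have [b0 b0P] : exists b0 : {linear P 0%N -> R^o}, forall x,
  pi_fun I (b0 x) = eps x.
  apply: projective_lift => // x; have [z ->] := quotmod_surj (eps x).
  by exists z.
have [b1 b1P] : exists b1 : {linear P 1%N -> 'rV[R]_r}, forall x,
    free_map gen (b1 x) = b0 (d 0%N x).
  pose g := (b0 \o d 0%N)%FUN : {linear P 1%N -> R^o}.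
  apply: (@projective_lift _ _ _ _ (free_map gen) g) => // x.
  have [|v xv] := @gen_onto (b0 (d 0%N x)); last by exists v; apply: esym xv.
  by apply/pi_fun_eq0; rewrite b0P; apply/eps_ker; exists x.
have [b2 b2P] : exists b2 : {linear P 2%N -> 'rV[R]_m}, forall x,
    b2 x *m D = b1 (d 1%N x).
  pose g := (b1 \o d 1%N)%FUN : {linear P 2%N -> 'rV[R]_r}.
  apply: (@projective_lift _ _ _ _ (mulmxr D) g) => // x.
  have [|w w_eq] := (rel (b1 (d 1%N x))).1; last by exists w.
  rewrite b1P (_ : d 0%N (d 1%N x) = 0) ?linear0 //.
  by apply/d_ker; exists x.
have [h hP] : exists h, b0 p0 - 1 = free_map gen h.
  by apply: gen_onto; apply/pi_fun_eq0; rewrite linearB /= b0P eps_p0 subrr.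
have /boolp.choice[k kP] : forall a, exists k,
    b1 (q a) - delta_mx 0 a - gen a *: h = k *m D.
  move=> a; apply/rel; rewrite !linearB linearZ /= -hP free_map_delta b1P qP.
  by rewrite linearZ /= scalerBr [_ *: 1]mulr1 subrr.
pose B := \matrix_a b1 (q a).
pose U : 'cV[R]_r := \col_a gen a.
have B_eq : B = 1%:M + U *m h + (\matrix_a k a) *m D.
  apply/row_matrixP => a; rewrite rowK !linearD /= row1 !row_mul rowK -kP.
  rewrite (_ : row a U *m h = gen a *: h);
    first by rewrite addrC (addrC (delta_mx 0 a)) addrA !subrK.
  by rewrite (_ : row a U = (gen a)%:M) ?mul_scalar_mx //; apply/rowP=> j;
    rewrite !mxE (ord1 j).
have b1_q v : b1 (free_map q v) = v *m B.
  by rewrite linear_free_map free_map_rows.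
pose T := \matrix_k b2 (y k).
have T_eq : T *m D = D *m B.
  by apply/row_matrixP => a; rewrite row_mul rowK b2P yP b1_q row_mul.
have DU : D *m U = 0.
  apply/row_matrixP => a; rewrite row_mul row0.
  have : free_map gen (row a D) = 0 by apply/rel; exists (delta_mx 0 a);
    rewrite -rowE.
  move=> Da; apply/rowP=> j; rewrite mxE mxE -[RHS]Da.
  by apply: eq_bigr => c _; rewrite !mxE.
exists (T - D *m \matrix_a k a); split=> [|v vD|l1].
- rewrite mulmxBl T_eq B_eq !mulmxDr mulmx1 mulmxA DU mul0mx addr0 -mulmxA.
  by rewrite addrK.
- rewrite mulmxBr mulmxA vD mul0mx subr0 -free_map_rows -linear_free_map y_inj
  //.
  exact: linear0.
exists (- \matrix_a k a); rewrite mulmxN (_ : T = 0) ?add0r //.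
by apply/row_matrixP => a; rewrite rowK row0 (P0 2 _ (y a)) ?linear0.
Qed.

(** The resolution is [0 -> R^m -> R^r -> R -> R/I], continued by zero modules. *)
Lemma pdim_le2_free : (forall w : 'rV_m, w *m D = 0 -> w = 0) ->
  pdim_le (quotmod I) 2.
Proof.
move=> D_inj.
pose b i := if i is i'.+1 then (if i' is i''.+1 then (if i'' is 0 then m else
  0%N) else r) else 1%N.
pose U : 'cV[R]_r := \col_a gen a.
pose A i : 'M[R]_(b i.+1, b i) :=
  match i return 'M[R]_(b i.+1, b i) with 0 => U | 1 => D | _ => 0 end.
pose e (k : 'I_1) : quotmod I := pi_fun I 1.
have e_pi (v : 'rV[R]_1) : free_map e v = pi_fun I (v 0 0).
  by rewrite /free_map big_ord1 -linearZ /= [_ *: _]mulr1.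
have mulU v : v *m U = (free_map gen v)%:M.
  apply/rowP=> j; rewrite (ord1 j) !mxE mulr1n; apply: eq_bigr => a _.
  by rewrite mxE.
exists (fun i => 'rV[R]_(b i) : lmodType R), (fun i => mulmxr (A i)),
  (free_map e).
split; last by case=> [|[|[|i]]] // _ x; apply/rowP; case.
split=> [i|y|x|].
- exact: free_projective.
- have [z ->] := quotmod_surj y; exists (z%:M).
  by rewrite [LHS]e_pi mxE mulr1n.
- rewrite -[X in X = 0]/(free_map e x) e_pi pi_fun_eq0;
  split=> [/gen_onto[v xv]|[v <-]].
    by exists v; rewrite /= mulU -xv; apply/rowP=> j;
      rewrite (ord1 j) mxE mulr1n.
  by rewrite /= mulU mxE mulr1n; apply: gen_in.
case=> [|[|i]] x.
- rewrite /= mulU; split=> [/matrixP/(_ 0 0)|[w xw]].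
    by rewrite !mxE mulr1n => /rel[w ->]; exists w.
  by rewrite (_ : free_map gen _ = 0) ?raddf0 //; apply/rel; exists w.
- split=> [/D_inj->|[w <-]]; first by exists 0; rewrite /= mul0mx.
  by rewrite /= mulmx0 mul0mx.
- split=> _; last by rewrite /= mulmx0.
  by exists 0; apply/rowP; case.
Qed.

End IdealPresentation.

(** * Resolutions of squarefree monomial ideals of grade two *)

Lemma det_neq0_inj (R : idomainType) m (N : 'M[R]_m) (c : 'rV[R]_m) :
  \det N != 0 -> c *m N = 0 -> c = 0.
Proof.
move=> detN cN; apply/eqP; apply: contraNT detN => c0.
by apply/det0P; exists c.
Qed.

(** Nakayama's lemma in the form needed here: a matrix with constant terms [0]
    cannot have an eigenvalue with a nonzero constant term. *)
Lemma det_const_term (K : fieldType) n m (N : 'M[{mpoly K[n]}]_m) g :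
  (forall i j, (N i j)@_0%MM = 0) -> g@_0%MM != 0 -> \det (g%:M + N) != 0.
Proof.
move=> N0 g0; apply: contraTneq (expf_neq0 m g0) => det0.
rewrite negbK -det_scalar; apply/eqP.
rewrite -[RHS](mcoeff0 K (0%MM : 'X_{1..n})) -det0 -(det_map_mx (mcoeff 0%MM)).
by congr (\det _); apply/matrixP=> i j;
  rewrite !mxE /= mcoeffD N0 addr0 mcoeffMn.
Qed.

Section GradeTwo.
Variables (K : fieldType) (n r : nat) (u : 'I_r -> {set 'I_n}).
Local Notation S := {mpoly K[n]}.
Local Notation gen := (sqfree_gen K u).
Local Notation trow := (taylor_row K u).
Local Notation D := (taylor_mx K u).
Variable I : idealOf S.
Hypothesis I_gen : I =i sqfree_ideal K u.
Hypothesis antichain : forall a b, u a \subset u b -> a = b.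

Lemma taylor_row_const a b c : (trow a b 0 c)@_0%MM = 0.
Proof.
have [->|nab] := eqVneq a b; first by rewrite /taylor_row subrr mxE mcoeff0.
have coef0 d e : d != e -> (taylor_coef K u d e)@_0%MM = 0.
  move=> nde; rewrite mcoeffX; case: eqP => // /mnmP s0.
  suff /antichain/esym/eqP : u e \subset u d by rewrite (negPf nde).
  rewrite -setD_eq0; apply/eqP/setP=> x; rewrite [RHS]inE; have := s0 x.
  by rewrite smonE mnm0E; case: (x \in _).
have [->|nca] := eqVneq c a; first by rewrite taylor_row_in ?coef0.
have [->|ncb] := eqVneq c b.
  by rewrite taylor_rowN mxE mcoeffN taylor_row_in ?coef0 ?oppr0 // eq_sym.
by rewrite taylor_row_out // mcoeff0.
Qed.

Lemma taylor_mx_const k c : (D k c)@_0%MM = 0.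
Proof. by rewrite mxE taylor_row_const. Qed.

Lemma taylor_split l : pdim_le (quotmod I) l -> (l <= 2)%N ->
  exists Q, [/\ Q *m D = D, forall v : 'rV_ _, v *m D = 0 -> v *m Q = 0
    & (l <= 1)%N -> exists H, Q = D *m H].
Proof.
apply: (@pdim_le2_split S I _ _ gen).
- exact: syz_in.
- exact: syz_onto.
- exact: syz_taylor_mx.
Qed.

(** If [I] were projective, then [D = D *m H *m D] for some [H], which forces
    [D = 0] as the constant terms of [D] vanish; but any two generators have a
    nonzero Taylor relation. *)
Lemma pdim_ge2 l : (2 <= r)%N -> pdim_le (quotmod I) l -> (2 <= l)%N.
Proof.
move=> r2 pd; rewrite leqNgt; apply/negP=> l1.
have [Q [QD _ /(_ l1)[H QH]]] := taylor_split pd (ltnW l1).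
pose N := - (D *m H).
have N0 i j : (N i j)@_0%MM = 0.
  rewrite !mxE mcoeffN raddf_sum big1 ?oppr0 // => c _ /=.
  by rewrite (rmorphM (mcoeff 0%MM)) /= taylor_mx_const mul0r.
have det1N : \det (1%:M + N) != 0.
  by apply: det_const_term => //; rewrite mcoeff1 eqxx oner_neq0.
have ND : (1%:M + N) *m D = 0 by rewrite mulmxDl mul1mx mulNmx -QH QD subrr.
have /eqP : \det (1%:M + N) *: D = 0.
  by rewrite -mul_scalar_mx -mul_adj_mx -mulmxA ND mulmx0.
rewrite scalemx_eq0 (negPf det1N) /= => /eqP D0.
pose a : 'I_r := Ordinal (ltnW r2); pose b : 'I_r := Ordinal r2.
have := congr1 (fun M : 'M_(_, _) => M (enum_rank (a, b)) a) D0.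
rewrite mxE enum_rankK [RHS]mxE /= taylor_row_in // => /eqP.
by rewrite (negPf (mpolyX_neq0 _ _)).
Qed.

Lemma spanning_forest_order (C : {set 'I_r}) (s : seq ('I_r * 'I_r)) (l : seq
  'I_r) :
  C =i l -> spanning_forest C s ->
  forall e, e \in s ->
    (index e.2 (l ++ map fst s) < index e.1 (l ++ map fst s))%N.
Proof.
elim: s C l => [|e s IH] C l Cl //= /and3P[e2 e1 sC] e'.
rewrite inE -cat_rcons => /predU1P[->|]; last first.
  by apply: IH sC _; move=> x; rewrite !inE mem_rcons inE Cl.
rewrite !index_cat !mem_rcons !inE eqxx /= -cats1 !index_cat -!Cl e2 orbT
  (negPf e1) /=.
by rewrite eqxx addn0 index_mem -Cl.
Qed.

(** An efficient tree is a resolution: when its vertices are eliminated from the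
    leaves to the root, a variable lost along the edge to a leaf is present in
    all the remaining generators. *)
Lemma tree_resolution i s : spanning_forest [set i] s ->
  (forest_exp u s <= smon (u i))%MM -> pdim_le (quotmod I) 2.
Proof.
move=> sC s_le; have [lossS loss_once] := forest_exp_le s_le.
pose T : 'M[S]_(size s, r) :=
  \matrix_k trow (tnth (in_tuple s) k).1 (tnth (in_tuple s) k).2.
apply: (@pdim_le2_free S I _ _ gen T).
- exact: syz_in.
- exact: syz_onto.
- move=> v; split=> [|[w ->]]; last first.
    rewrite -[LHS]/(syz u (w *m T)) mulmx_sum_row syz_sum big1 // => k _.
    by rewrite syzZ rowK syz_taylor mulr0.
  pose d a := index a (i :: map fst s).
  have d_lt e : e \in s -> (d e.2 < d e.1)%N.
    by apply: (@spanning_forest_order _ s [:: i] _ sC) => x; rewrite !inE.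
  have d_mem : forall a, a \in i :: map fst s.
    apply: (spanning_forest_ind sC) => [c|e es _].
      by rewrite !inE => ->.
    by rewrite inE map_f ?orbT.
  apply: (@syz_elimination K n r u (fun v => exists w, v = w *m T) d).
  + by exists 0; rewrite mul0mx.
  + by move=> c _ _ [w1 ->] [w2 ->]; exists (c *: w1 + w2);
    rewrite mulmxDl scalemxAl.
  + by move=> a b eq_d; rewrite -(nth_index i (d_mem a)) -/(d a) eq_d nth_index.
  move=> l a lt_a.
  have : l \in i :: map fst s by [].
  rewrite inE => /predU1P[li|/mapP[e es le]]; first by move: lt_a;
    rewrite li /d /= eqxx.
  exists e.2; rewrite le; split; first exact: d_lt.
    have /tnthP[k e_k] : e \in in_tuple s by [].
    by exists (delta_mx 0 k); rewrite -rowE rowK -e_k.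
  apply/subsetP=> x xe.
  have all_x : forall v, (d v < d e.1)%N -> x \in u v.
    apply: (spanning_forest_ind sC) => [c|e' e's IH lt_e'].
      by rewrite inE => /eqP-> _; apply: (subsetP (lossS e es)).
    have xe2 := IH (ltn_trans (d_lt e' e's) lt_e').
    apply: contraT => xe1; have xe' : x \in edge_loss u e' by rewrite inE xe1.
    by rewrite (loss_once x e' e) ?ltnn in lt_e'.
  by move: xe; rewrite !inE => /andP[-> _]; rewrite all_x // -le.
move=> w wT.
apply: (@det_neq0_inj S (size s) (edge_minor K u (tnth (in_tuple s))
          (fun l => (tnth (in_tuple s) l).1))).
  by rewrite (forest_minor K u sC) mpolyX_neq0.
apply/rowP=> l; rewrite [RHS]mxE.
have /rowP/(_ (tnth (in_tuple s) l).1) := wT; rewrite [RHS]mxE => <-.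
rewrite [LHS]mxE [RHS]mxE; apply: eq_bigr => k _; congr (_ * _).
by rewrite [LHS]mxE [RHS]mxE.
Qed.

(** The splitting makes some of the Taylor relations a free basis of all
    relations, up to an element [g] with nonzero constant term. These relations are
    a minimal set generating up to such a [g]: minimality alone forces the
    coefficients of a relation among them to have constant term [0]. *)
Lemma free_relations : pdim_le (quotmod I) 2 ->
  exists (E : {set 'I_#|{: 'I_r * 'I_r}|}) g Y,
    [/\ g@_0%MM != 0, g *: D = Y *m D, forall k e, e \notin E -> Y k e = 0
      & forall c : 'rV_ _, (forall e, e \notin E -> c 0 e = 0) -> c *m D = 0 ->
        c = 0].
Proof.
move=> pd; have [Q [QD DQ _]] := taylor_split pd (leqnn 2).
pose Gen (E : {set 'I_#|{: 'I_r * 'I_r}|}) := exists g Y,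
  [/\ g@_0%MM != 0, g *: D = Y *m D & forall k e, e \notin E -> Y k e = 0].
have [|E /minsetP[/asboolP[g [Y [g0 gD Y_supp]]] E_min]] :=
    @ex_minset _ (fun E => `[< Gen E >]).
  exists setT; apply/asboolP; exists 1, 1%:M; split=> [||k e];
    last by rewrite inE.
    by rewrite mcoeff1 eqxx oner_neq0.
  by rewrite scale1r mul1mx.
(* a relation whose coefficient at e has a nonzero constant term would make e
   superfluous *)
have c_const (c : 'rV_ _) : (forall e, e \notin E -> c 0 e = 0) -> c *m D = 0 ->
    forall e, (c 0 e)@_0%MM = 0.
  move=> c_supp cD e; apply/eqP; apply: contraT => ce.
  have eE : e \in E by apply: contraNT ce => /c_supp->; rewrite mcoeff0.
  suff /E_min/(_ (subsetDl _ _))/setP/(_ e) : `[< Gen (E :\ e) >] by rewrite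
    !inE eqxx eE.
  apply/asboolP; exists (c 0 e * g), (c 0 e *: Y - col e Y *m c); split.
  - by rewrite (rmorphM (mcoeff 0%MM)) /= mulf_neq0.
  - by rewrite mulmxBl -mulmxA cD mulmx0 subr0 -scalemxAl -gD scalerA.
  move=> k e'; rewrite !inE negb_and negbK => e'E.
  rewrite !mxE big_ord1 !mxE; case/orP: e'E => [/eqP->|e'E].
    by rewrite mulrC subrr.
  by rewrite (Y_supp k e') // (c_supp e') // !mulr0 subr0.
exists E, g, Y; split=> // c c_supp cD.
pose N := Q *m Y - g%:M.
have ND : N *m D = 0 by rewrite mulmxBl -mulmxA -gD -scalemxAr QD mul_scalar_mx
  subrr.
(* the rows outside E do not meet the support of c; dropping them makes all
   constant terms vanish *)
pose N' : 'M[S]_#|{: 'I_r * 'I_r}| :=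
  \matrix_k (if k \in E then row k N else 0).
have N'0 i j : (N' i j)@_0%MM = 0.
  rewrite mxE; case: (boolP (i \in E)) => iE; last by rewrite mxE mcoeff0.
  apply: c_const; last by rewrite -row_mul ND row0.
  move=> e eE; rewrite !mxE big1 => [|l _]; last by rewrite Y_supp ?mulr0.
  by rewrite (_ : i == e = false) ?subrr //; apply: contraNF eE => /eqP<-.
apply: (det_neq0_inj (det_const_term N'0 g0)).
have cN : c *m N' = c *m N.
  rewrite !mulmx_sum_row; apply: eq_bigr => k _; rewrite rowK.
  by case: (boolP (k \in E)) => // /c_supp->; rewrite !scale0r.
by rewrite mulmxDr cN mulmxBr mulmxA DQ // mul0mx sub0r addrN.
Qed.

End GradeTwo.

(** Hilbert-Burch for monomials. Expressing the relations between [u a] and the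
    other generators by the free relations bounds some maximal minor of these by
    a power of [u a]. All maximal minors are monomials whose exponents differ from
    those of the generators by the same vector, which therefore vanishes, since no
    variable divides all the generators. *)
Lemma grade_two_forests (K : fieldType) n k (u : 'I_k.+1 -> {set 'I_n})
    (I : idealOf {mpoly K[n]}) :
  I =i sqfree_ideal K u -> (forall x, exists a, x \notin u a) ->
  pdim_le (quotmod I) 2 ->
  forall a, exists2 s, spanning_forest [set a] s & forest_exp u s = smon (u a).
Proof.
move=> I_gen no_common pd.
have [E [g [Y [g0 gD Y_supp E_free]]]] := free_relations I_gen pd.
set D := taylor_mx K u in gD E_free; set M := #|_| in E Y D gD Y_supp E_free.
have E_small : (#|E| <= k)%N.
  rewrite leqNgt; apply/negP=> ltE.
  pose e (i : 'I_k.+1) : 'I_M := enum_val (widen_ord ltE i).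
  have e_inj : injective e by move=> i j /enum_val_inj/(congr1 val) /= eq_ij;
    apply: val_inj.
  have : \det (rowsub e D) == 0.
    rewrite -det_tr; apply/det0P; exists (\row_b sqfree_gen K u b).
      apply/eqP=> /rowP/(_ 0); rewrite !mxE => /eqP.
      by rewrite (negPf (sqfree_gen_neq0 _ _ _)).
    apply/rowP=> i; rewrite mxE [RHS]mxE -[RHS](syz_taylor K u (enum_val (e
      i)).1 (enum_val (e i)).2).
    by apply: eq_bigr => b _; rewrite mulrC !mxE.
  case/det0P=> v v0 vD; case/negP: v0; apply/eqP.
  have := E_free (v *m rowsub e 1%:M) _ _.
  rewrite -mulmxA mul_rowsub_mx mul1mx vD => cE.
  have {cE} c0 : v *m rowsub e 1%:M = 0.
    apply: cE => // e' e'E; rewrite mxE big1 // => i _; rewrite !mxE.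
    rewrite (_ : e i == e' = false) ?mulr0 //.
    by apply: contraNF e'E => /eqP<-; apply: enum_valP.
  apply/rowP=> i; rewrite [RHS]mxE.
  have /rowP/(_ (e i)) := c0; rewrite [RHS]mxE => <-.
  rewrite [RHS]mxE (bigD1 i) //= !mxE eqxx mulr1 big1 ?addr0 // => j ji.
  by rewrite !mxE (inj_eq e_inj) (negPf ji) mulr0.
pose lcm (e : 'I_M) := smon (u (enum_val e).1 :|: u (enum_val e).2).
have minor a : exists s, [/\ spanning_forest [set a] s,
    (forest_exp u s <= smon (u a) *+ k)%MM &
    (forest_exp u s + \sum_(b < k) smon (u (lift a b)) = \sum_(e in E) lcm
      e)%MM].
  have /boolp.choice[w wP] : forall b : 'I_k, exists w : 'rV[{mpoly K[n]}]_M,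
    w *m D =
      sqfree_gen K u a *: delta_mx 0 (lift a b) - sqfree_gen K u (lift a b) *:
        delta_mx 0 a.
    move=> b; set sg := (_ *: delta_mx 0 (lift a b) - _).
    have /syz_taylor_mx[w ->] : syz u sg = 0.
      by rewrite syzB !syzZ !syz_delta mulrC subrr.
    by exists w.
  pose W := \matrix_b w b.
  (* without the column a, the relations between a and the other generators form
     a scalar matrix *)
  have gW : (g * sqfree_gen K u a)%:M = (W *m Y) *m colsub (lift a) D.
    have -> : W *m Y *m colsub (lift a) D = colsub (lift a) (W *m Y *m D).
      by apply/matrixP=> b b'; rewrite !mxE; apply: eq_bigr => l _;
        rewrite [colsub _ _ _ _]mxE.
    rewrite -mulmxA -gD -scalemxAr; apply/matrixP=> b b'.
    have := congr1 (fun v : 'rV_ _ => v 0 (lift a b')) (wP b).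
    have -> : (w b *m D) 0 (lift a b') = (W *m D) b (lift a b').
      by rewrite !mxE; apply: eq_bigr => l _; rewrite !mxE.
    move=> WD; rewrite [RHS]mxE [RHS]mxE WD.
    rewrite !mxE eqxx /= (inj_eq (@lift_inj _ a)) (eq_sym (lift a b')) (negPf
      (neq_lift a b')).
    by rewrite mulr0 subr0 mulrA mulr_natr eq_sym.
  pose G m := exists2 s, spanning_forest [set a] s & m = forest_exp u s /\
    (forest_exp u s + \sum_(b < k) smon (u (lift a b)) = \sum_(e in E) lcm
      e)%MM.
  have : (g * sqfree_gen K u a) ^+ k \in monomial_ideal K G.
    rewrite -det_scalar gW det_mulmx_expand; apply: ideal_sum => h _.
    have [/existsP[b hb]|] := boolP [exists b, h b \notin E].
      rewrite (bigD1 b) //= (_ : (W *m Y) b (h b) = 0) ?mul0r ?ideal0 //.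
      by rewrite mxE big1 // => l _; rewrite Y_supp ?mulr0.
    rewrite negb_exists => /forallP hE; apply: idealMl.
    have [/injectiveP h_inj|/injectivePn[b [b' nb hb]]] :=
      boolP (injectiveb h); last first.
      rewrite (determinant_alternate nb); first exact: ideal0.
      by move=> l; rewrite !mxE hb.
    rewrite (_ : rowsub h _ = edge_minor K u (fun b =>
      enum_val (h b)) (lift a)); last first.
      by apply/matrixP=> b b'; rewrite [LHS]mxE mxE [D _ _]mxE [RHS]mxE.
    have [->|[s [c [sC -> exp_s]]]] :=
        @edge_minor_forest K n _ u k (fun b =>
          enum_val (h b)) (lift a) (@lift_inj _ a).
      exact: ideal0.
    apply: idealMl; apply: mem_ideal_gen; exists (forest_exp u s) => //.
    have set_a : ~: [set lift a l | l : 'I_k] = [set a].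
      apply/setP=> x; rewrite !inE; case: (unliftP a x) => [b ->|->].
        by rewrite imset_f // eq_sym (negPf (neq_lift _ _)).
      by rewrite eqxx; apply/imsetP=> -[b _ /eqP];
        rewrite (negPf (neq_lift _ _)).
    exists s; first by rewrite -set_a.
    split=> //; rewrite exp_s.
    have hE_eq : [set h b | b : 'I_k] = E.
      apply/eqP; rewrite eqEcard (card_imset _ h_inj) card_ord E_small andbT.
      by apply/subsetP=> _ /imsetP[b _ ->]; have := hE b; rewrite negbK.
    by rewrite -hE_eq big_imset //= => x y _ _; apply: h_inj.
  move=> /mem_monomial_ideal/(_ ((smon (u a) *+ k) + 0)%MM)[].
    rewrite mcoeff_msupp exprMn mpolyXn mcoeffMX (rmorphXn (mcoeff 0%MM)) /=.
    exact: expf_neq0.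
  by rewrite addm0 => m [s sC [-> exp_s]] le_m; exists s.
move=> a; have [s [sC s_le exp_s]] := minor a; exists s => //.
apply/mnmP=> x; have [a0 xa0] := no_common x.
have [s0 [_ s0_le exp_s0]] := minor a0.
have total (b : 'I_k.+1) : (\sum_(d < k) smon (u (lift b d)) + smon (u b) =
  \sum_d smon (u d))%MM.
  by rewrite [RHS](bigD1_ord b) //= addmC.
have /mnm_lepP/(_ x) := s0_le;
  rewrite mulmnE smonE (negPf xa0) mul0n leqn0 => /eqP s0x.
have /mnmP/(_ x) := exp_s; have /mnmP/(_ x) := exp_s0.
have /mnmP/(_ x) := total a; have /mnmP/(_ x) := total a0.
rewrite !mnmDE s0x !smonE (negPf xa0) => tot0 tot e0 e1.
by lia.
Qed.

(** * Squarefree monomial ideals equal to a Fitting ideal *)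

Section Assembly.
Variables (K : fieldType) (n : nat).
Local Notation S := {mpoly K[n]}.

(** [u] enumerates the minimal supports of squarefree monomials of [I]; the support
    of each given generator contains one of them. *)
Lemma squarefree_antichain (I : idealOf S) : squarefree_monomial_ideal I ->
  exists r (u : 'I_r -> {set 'I_n}),
    (forall a b, u a \subset u b -> a = b) /\ I =i sqfree_ideal K u.
Proof.
move=> [G G_sqfree IG].
pose mem_I (A : {set 'I_n}) := 'X_[K, smon A] \in I.
pose M := [set A | minset mem_I A].
exists #|M|, (fun a => enum_val a); split=> [a b sub_ab|].
  have min_u (c : 'I_#|M|) : minset mem_I (enum_val c) by have := enum_valP c;
    rewrite inE.
  apply: enum_val_inj; have /minsetP[Ia _] := min_u a.
  by have /minsetP[_] := min_u b; apply.
suff [GM MG] : {subset I <= sqfree_ideal K (fun a : 'I_#|M| => enum_val a)} /\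
    {subset sqfree_ideal K (fun a : 'I_#|M| => enum_val a) <= I}.
  by move=> f; apply/idP/idP; [apply: GM|apply: MG].
split=> [f|]; last first.
  apply: (ideal_genP _ _).1 => _ [_ [a ->] ->].
  by have := enum_valP a; rewrite inE => /minsetP[].
rewrite IG; apply: ideal_genS => _ [m Gm ->]; pose A := [set i | m i != 0%N].
have m_smon : m = smon A.
  apply/mnmP=> i; rewrite smonE inE; have := G_sqfree m Gm i.
  by case: (m i) => [|[]].
have [|B B_min BA] := @minset_exists _ mem_I A.
  by rewrite /mem_I -m_smon IG; apply: mem_ideal_gen; exists m.
have BM : B \in M by rewrite inE.
apply/monomial_in_ideal; exists (smon B); last by rewrite m_smon smon_leS.
by exists (enum_rank_in BM B); rewrite enum_rankK_in.
Qed.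

Section Antichain.
Variables (r : nat) (u : 'I_r -> {set 'I_n}) (I : idealOf S).
Hypothesis antichain : forall a b, u a \subset u b -> a = b.
Hypothesis I_gen : I =i sqfree_ideal K u.
Hypothesis I_proper : 1 \notin I.
Local Notation gen := (sqfree_gen K u).

Lemma support_nonempty a : exists x, x \in u a.
Proof.
apply/set0Pn; apply: contra I_proper => /eqP ua.
have := sqfree_gen_in I_gen a; rewrite /sqfree_gen ua.
rewrite (_ : smon set0 = 0%MM) ?mpolyX0 //.
by apply/mnmP=> i; rewrite smonE inE mnm0E.
Qed.

Lemma const_term_ideal_seq (s : seq S) f : (forall g, g \in s -> g@_0%MM = 0) ->
  f \in ideal_seq s -> f@_0%MM = 0.
Proof.
move=> s0 /ideal_seqP[a ->]; rewrite raddf_sum big1 // => i _ /=.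
by rewrite (rmorphM (mcoeff 0%MM)) /= (s0 s`_i) ?mem_nth ?mulr0.
Qed.

(** A cover [W] puts [I] in the ideal generated by the variables of [W], to which
    the bound on the length of regular sequences applies. *)
Lemma grade_le_cover g W : has_grade I g -> cover u W -> (g <= #|W|)%N.
Proof.
move=> [s [s_reg sI _] <-] covW.
pose vars : seq S := [seq 'X_x | x <- enum W].
have size_vars : size vars = #|W| by rewrite size_map -cardE.
have vars_seq : mkseq (nth 0 vars) #|W| = vars by rewrite -size_vars mkseq_nth.
apply: (regular_seq_size_le (x := nth 0 vars)) => //; rewrite vars_seq.
  apply/negP=> one; have : (1 : S)@_0%MM = 0.
    apply: const_term_ideal_seq one => _ /mapP[x _ ->].
    by rewrite mcoeffX mnm1_eq0.
  by rewrite mcoeff1 eqxx => /eqP; rewrite oner_eq0.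
move=> f /sI; rewrite I_gen; apply: (ideal_genP _ (ideal_seq vars)).1.
move=> _ [_ [a ->] ->]; have [x xW xa] := covW a.
rewrite (@mpolyX_dvd K n U_(x)%MM); last by rewrite lep1mP smonE xa.
by apply/idealMl/mem_ideal_seq/map_f; rewrite mem_enum.
Qed.

Variable j : nat.
Hypothesis hj : (2 <= j)%N.
Hypothesis I_grade : exists2 g, has_grade I g & (j <= g)%N.

Lemma cover_large W : cover u W -> (j.-1 < #|W|)%N.
Proof.
move=> covW; have [g gI le_g] := I_grade.
by apply: leq_trans (grade_le_cover gI covW); case: j hj le_g.
Qed.

Lemma gens_large : (j.-1 < r)%N.
Proof. by apply: cover_size_le support_nonempty cover_large. Qed.

Local Notation F := (Fitt j.-1 (submod I)).

(** A forest monomial is divisible by a generator, since otherwise the variables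
    outside its support would cover all generators too cheaply. *)
Lemma Fitt_sub : {subset F <= I}.
Proof.
apply: (Fitt_forest I_gen) (ltnW gens_large) _ => C s sC cardC.
have [|a ua] := forest_support_gen sC (u := u); first by rewrite cardC;
  apply: cover_large.
by rewrite I_gen; apply/monomial_in_ideal; exists (smon (u a));
  [exists a|rewrite smon_le].
Qed.

Lemma Fitt_eq : (forall a, gen a \in F) -> F =i I.
Proof.
move=> genF f; apply/idP/idP; first exact: Fitt_sub.
rewrite I_gen; apply: (ideal_genP _ F).1 => _ [_ [a ->] ->].
exact: genF.
Qed.

Lemma Fitt_efficient i : gen i \in F -> exists C s,
  [/\ spanning_forest C s, #|C| = j.-1 & (forest_exp u s <= smon (u i))%MM].
Proof.
pose G m := exists C s, [/\ spanning_forest C s,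
  #|C| = j.-1 & m = forest_exp u s].
have FG : {subset F <= monomial_ideal K G}.
  apply: (Fitt_forest I_gen) (ltnW gens_large) _ => C s sC cardC.
  by apply: mem_ideal_gen; exists (forest_exp u s) => //; exists C, s.
by move=> /FG/monomial_in_ideal[_ [C [s [sC cardC ->]]] le_s]; exists C, s.
Qed.

Lemma star_forest (C : {set 'I_r}) (a : 'I_r) (l : seq 'I_r) :
  a \in C -> uniq l -> l =i ~: C ->
  spanning_forest C [seq (v, a) | v <- l].
Proof.
elim: l C => [|v l IH] C /= aC l_uniq lC.
  by apply/eqP/setP=> x; have := lC x; rewrite !inE => /esym/negbFE.
case/andP: l_uniq => vl l_uniq; have := lC v; rewrite mem_head inE => /esym vC.
rewrite aC vC /=; apply: IH => [||x]; rewrite ?inE ?aC ?orbT //.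
have := lC x; rewrite !inE; have [->|_] //= := eqVneq x v.
by rewrite (negPf vl).
Qed.

(** All edges of a star with parent [a] lose only variables of [u a]. Hence [I] and
    its Fitting ideal have the same radical, so that they agree as soon as the
    latter is squarefree. *)
Lemma gen_power_in_Fitt a : exists N, 'X_[K, smon (u a) *+ N] \in F.
Proof.
have [C aC cardC] : exists2 C : {set 'I_r}, a \in C & #|C| = j.-1.
  pose l := take j.-2 (enum [set~ a]).
  have l_sub x : x \in l -> x != a.
    by move/mem_take; rewrite mem_enum !inE.
  exists (a |: [set x in l]); first exact: setU11.
  rewrite cardsU1 inE (contraTN (l_sub a)) ?eqxx //= cardsE.
  have /card_uniqP -> : uniq l by rewrite take_uniq ?enum_uniq.
  rewrite size_takel; first by move: hj; lia.
  by rewrite -cardE cardsC1 card_ord; have := gens_large; lia.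
pose s := [seq (v, a) | v <- enum (~: C)].
have sC : spanning_forest C s.
  by apply: star_forest; rewrite ?enum_uniq // => x; rewrite mem_enum.
exists (size s); rewrite (@mpolyX_dvd K n (forest_exp u s)).
  by apply: idealMl; apply: forest_in_Fitt cardC.
apply/mnm_lepP=> x; rewrite forest_expE mulmnE smonE.
have [xa|xa] := boolP (x \in u a); first by rewrite mul1n count_size.
rewrite mul0n leqn0 -leqn0 leqNgt -has_count; apply/hasPn => _ /mapP[v _ ->].
by rewrite inE negb_and xa orbT.
Qed.

Lemma Fitt_squarefree : squarefree_monomial_ideal F -> F =i I.
Proof.
move=> [G G_sqfree FG]; apply: Fitt_eq => a; rewrite FG.
have [N] := gen_power_in_Fitt a; rewrite FG => /monomial_in_ideal[m Gm le_m].
apply/monomial_in_ideal; exists m => //; apply/mnm_lepP=> x.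
have := mnm_lepP le_m x; rewrite mulmnE smonE; case: (x \in u a);
  last by rewrite mul0n.
by move=> _; apply: G_sqfree.
Qed.

Lemma pdim_leW (M : lmodType S) k l : (k <= l)%N -> pdim_le M k -> pdim_le M l.
Proof.
move=> le_kl [P [d [eps [res P0]]]]; exists P, d, eps; split=> // i lt_i.
by apply: P0; apply: leq_ltn_trans lt_i.
Qed.

Lemma Fitt1_perfect : j = 2%N -> F =i I -> perfect I /\ has_grade I 2.
Proof.
move=> j2 FI; have forest a : exists C s, [/\ spanning_forest C s, #|C| = 1%N &
    (forest_exp u s <= smon (u a))%MM].
  by have := @Fitt_efficient a; rewrite FI j2; apply; apply: sqfree_gen_in.
have r2 : (2 <= r)%N by have := gens_large; rewrite j2.
pose i : 'I_r := Ordinal (ltnW r2).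
have [x xi] := support_nonempty i; have [C [s [sC cardC s_le]]] := forest i.
have iC := root_mem antichain x sC s_le.
have [W covW le_W] := small_cover antichain xi sC s_le.
have grade2 : has_grade I 2.
  have [g gI le_g] := I_grade; suff <- : g = 2%N by [].
  have le2 : (g <= 2)%N.
    by apply: leq_trans (grade_le_cover gI covW) _;
      rewrite -[2%N]/(1.+1) -cardC.
  by apply/eqP; rewrite eqn_leq le2 -j2.
split=> //; exists 2%N => //; split=> [|l]; last exact: (pdim_ge2 I_gen).
apply: (tree_resolution I_gen _ s_le).
suff -> : [set i] = C by [].
by apply/eqP; rewrite eqEcard sub1set iC cards1 cardC.
Qed.

(** The maximal regular sequence of length two bounds the grade that appears in
    the definition of perfection, and with it the projective dimension. *)
Lemma perfect_Fitt1 : j = 2%N -> perfect I -> has_grade I 2 -> F =i I.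
Proof.
move=> j2 [g gI [pd _]] I2; apply: Fitt_eq => a.
have {}pd : pdim_le (quotmod I) 2 by apply: pdim_leW pd; apply: grade2_max gI.
have no_common x : exists a, x \notin u a.
  apply: contrapT => all_x; have /cover_large : cover u [set x].
    move=> b; exists x; first exact: set11.
    by apply: contraT => xb; case: all_x; exists b.
  by rewrite cards1 j2.
case: r u a I_gen no_common => [|k] u0 a0; first by case: a0.
move=> I_gen0 no_common.
have [s sC s_eq] := grade_two_forests I_gen0 no_common pd a0.
rewrite /sqfree_gen -s_eq; apply: (forest_in_Fitt I_gen0 sC).
by rewrite cards1 j2.
Qed.

Lemma mem_gens_seq (l : seq 'I_r) f :
  f \in ideal_seq [seq gen a | a <- l] <->
  (forall m, m \in msupp f -> exists2 a, a \in l & (smon (u a) <= m)%MM).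
Proof.
pose G m := exists2 a, a \in l & m = smon (u a).
have -> : (forall m, m \in msupp f -> exists2 a,
  a \in l & (smon (u a) <= m)%MM) <->
    f \in monomial_ideal K G.
  rewrite mem_monomial_ideal; split=> sf m /sf.
    by case=> a al le_m; exists (smon (u a)) => //; exists a.
  by case=> _ [a al ->]; exists a.
split.
  apply: ideal_seq_sub => _ /mapP[a al ->]; apply: mem_ideal_gen.
  by exists (smon (u a)) => //; exists a.
apply: (ideal_genP _ (ideal_seq _)).1 => _ [_ [a al ->] ->].
by apply/mem_ideal_seq/map_f.
Qed.

(** Multiplication by a generator that shares no variable with the earlier ones
    does not affect divisibility by these. *)
Lemma disjoint_regular : (forall a b, a != b -> [disjoint u a & u b]) ->
  exists s : seq S, [/\ regular_seq s, size s = r & I =i ideal_seq s].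
Proof.
move=> disj; pose s := [seq gen a | a <- enum 'I_r].
have Is : I =i ideal_seq s.
  move=> f; rewrite I_gen; apply/idP/idP.
    move/mem_sqfree_ideal=> sf; apply/mem_gens_seq => m /sf[a le_m].
    by exists a; rewrite ?mem_enum.
  move/mem_gens_seq=> sf; apply/mem_sqfree_ideal => m /sf[a _ le_m].
  by exists a.
exists s; split=> //; last by rewrite size_map size_enum_ord.
apply/regular_seqP; split=> [i|]; last by rewrite -Is.
rewrite size_map size_enum_ord => lt_i f; rewrite -map_take.
rewrite (nth_map (Ordinal lt_i)) ?size_enum_ord //.
set b := nth _ _ _; have b_i : b = i :> nat by rewrite nth_enum_ord.
move/mem_gens_seq=> sf; apply/mem_gens_seq => m mf.
have [|a al le_m] := sf (smon (u b) + m)%MM.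
  by rewrite mulrC (perm_mem (msuppMX _ _)) map_f.
have nab : a != b.
  have /(nthP b)[k lt_k <-] := al.
  have lt_ki : (k < i)%N by apply: leq_trans lt_k _;
    rewrite size_take_min geq_minl.
  rewrite nth_take //; apply: contraTneq (lt_ki) => /(congr1 val) /=.
  by rewrite b_i nth_enum_ord ?(ltn_trans lt_ki lt_i) // => ->; rewrite ltnn.
exists a => //; apply/mnm_lepP=> x; have := mnm_lepP le_m x.
rewrite mnmDE !smonE; have [xa|//] := boolP (x \in u a).
by rewrite (disjointFr (disj a b nab) xa).
Qed.

Lemma Fitt_regular : (2 < j)%N -> F =i I ->
  exists s : seq S, [/\ regular_seq s, size s = j & I =i ideal_seq s].
Proof.
move=> j3 FI; have r_le : (r <= j.-1.+1)%N.
  apply: (efficient_forests_few antichain); first by move: j3; lia.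
  - by have := gens_large; lia.
  - exact: support_nonempty.
  - exact: cover_large.
  - by move=> i; apply: Fitt_efficient; rewrite FI; apply: sqfree_gen_in.
have rj : r = j by have := gens_large; move: hj r_le; lia.
have disj := disjoint_of_few r_le support_nonempty cover_large.
by have [s [s_reg size_s Is]] := disjoint_regular disj; exists s;
  rewrite size_s.
Qed.

(** Modulo the maximal ideal the minimal generators stay independent. *)
Lemma gens_le_generators (s : seq S) : I =i ideal_seq s -> (r <= size s)%N.
Proof.
move=> Is; have coefM f c b : f \in I ->
    (c * f)@_(smon (u b)) = c@_0%MM * f@_(smon (u b)).
  move=> fI; pose c1 := c - (c@_0%MM)%:MP.
  have c10 : c1@_0%MM = 0 by rewrite mcoeffB mcoeffC eqxx mulr1 subrr.
  rewrite -[c in LHS](subrK (c@_0%MM)%:MP) -/c1 mulrDl mcoeffD mcoeffCM.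
  suff -> : (c1 * f)@_(smon (u b)) = 0 by rewrite add0r.
  apply/eqP; apply: contraT; rewrite -mcoeff_msupp =>
    /msuppM_le/allpairsP[[m1 m2] /=].
  case=> m1c m2f eq_m; have [a le_m2] :=
    (mem_sqfree_ideal u f).1 (etrans (esym (I_gen f)) fI) m2 m2f.
  have ab : a = b.
    apply: antichain; rewrite -smon_leS; apply: lepm_trans le_m2 _.
    by rewrite eq_m lem_addl.
  have m10 : m1 = 0%MM.
    apply/mnmP=> x; have := mnm_lepP le_m2 x; have /mnmP/(_ x) := eq_m.
    by rewrite mnmDE mnm0E ab; lia.
  by move: m1c; rewrite mcoeff_msupp m10 c10 eqxx.
have /boolp.choice[A genA] : forall a, exists c : 'I_(size s) -> S,
    gen a = \sum_i c i * s`_i.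
  by move=> a; apply/ideal_seqP; rewrite -Is; apply: sqfree_gen_in.
pose A0 : 'M[K]_(r, size s) := \matrix_(a, i) (A a i)@_0%MM.
pose B : 'M[K]_(size s, r) := \matrix_(i, b) (s`_i)@_(smon (u b)).
have AB : A0 *m B = 1%:M.
  apply/matrixP=> a b; rewrite !mxE.
  have <- : (gen a)@_(smon (u b)) = (a == b)%:R.
    rewrite mcoeffX; congr (_ : bool)%:R; apply/eqP/eqP => [eq_s|-> //].
    by apply: antichain; rewrite -smon_leS eq_s lepm_refl.
  rewrite genA raddf_sum; apply: eq_bigr => i _ /=.
  by rewrite !mxE coefM // Is; apply/mem_ideal_seq/mem_nth.
rewrite -(mxrank1 K r) -AB; apply: leq_trans (mxrankM_maxl _ _) _.
exact: rank_leq_col.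
Qed.

Lemma regular_Fitt : (2 < j)%N ->
  (exists s : seq S, [/\ regular_seq s, size s = j & I =i ideal_seq s]) ->
    F =i I.
Proof.
move=> j3 [s [_ size_s Is]].
have r_le : (r <= j.-1.+1)%N.
  by have := gens_le_generators Is; rewrite size_s; move: hj; lia.
have rj : r = j.-1.+1 by have := gens_large; move: r_le; lia.
have disj := disjoint_of_few r_le support_nonempty cover_large.
apply: Fitt_eq => a.
have [b nba] : exists b, b != a.
  have : (0 < #|[set~ a]|)%N by rewrite cardsC1 card_ord rj; move: j3; lia.
  by rewrite card_gt0 => /set0Pn[b]; rewrite !inE => ba; exists b.
have sC : spanning_forest [set~ b] [:: (b, a)].
  by rewrite /= !inE eqxx eq_sym nba; apply/eqP/setP=> x; rewrite !inE orbN.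
have -> : gen a = 'X_[forest_exp u [:: (b, a)]].
  rewrite /forest_exp big_seq1 /edge_loss /=; congr 'X_[smon _].
  by apply/esym/setDidPl; apply: disj; rewrite eq_sym.
apply: (forest_in_Fitt I_gen sC).
by rewrite cardsC1 card_ord rj.
Qed.

End Antichain.

End Assembly.

Theorem theorem3p3 (K : fieldType) (n j : nat) (I : idealOf {mpoly K[n]})
    (hj : (2 <= j)%N)
    (I_proper : 1 \notin I)
    (I_sqfree : squarefree_monomial_ideal I)
    (I_grade : exists2 g, has_grade I g & (j <= g)%N) :
  let F := Fitt j.-1 (submod I) in
  let cond_i := F =i I in
  let cond_ii := squarefree_monomial_ideal F in
  let cond_iii :=
    (j = 2%N -> perfect I /\ has_grade I 2%N) /\
    ((2 < j)%N -> exists s : seq {mpoly K[n]},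
       [/\ regular_seq s, size s = j & I =i ideal_seq s]) in
  (cond_i <-> cond_ii) /\ (cond_ii <-> cond_iii).
Proof.
move=> F cond_i cond_ii cond_iii.
have [r [u [antichain I_gen]]] := squarefree_antichain I_sqfree.
have i_ii : cond_i <-> cond_ii.
  split=> [FI|]; last exact: (Fitt_squarefree I_gen I_proper hj I_grade).
  have [G G_sqfree IG] := I_sqfree; exists G => // f.
  by rewrite FI IG.
split=> //; rewrite -i_ii; split=> [FI|[iii2 iii3]].
  split=> [j2|j3].
    exact: (Fitt1_perfect antichain I_gen I_proper hj I_grade j2 FI).
  exact: (Fitt_regular antichain I_gen I_proper hj I_grade j3 FI).
have [j2|j_neq2] := eqVneq j 2%N.
  have [I_perf I2] := iii2 j2.
  exact: (perfect_Fitt1 I_gen I_proper hj I_grade j2 I_perf I2).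
have j3 : (2 < j)%N by rewrite ltn_neqAle eq_sym j_neq2.
exact: (regular_Fitt antichain I_gen I_proper hj I_grade j3 (iii3 j3)).
Qed.
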